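(* For each $(\omega,\epsilon)\in D_n$, let $\widetilde\rho_{\omega,\epsilon}$ be the fundamental cycle of $\overline{\widetilde\Pi}_{\omega,\epsilon}$. Then $\{\widetilde\rho_{\omega,\epsilon}:(\omega,\epsilon)\in D_n,\ \omega(1)\ne n$ and all right-to-left maxima of $(\omega,\epsilon)$ are unbarred$\}$ is a basis for $\widetilde H_{n-2}(\overline{\Pi^D_n};\mathbb{Z})$.
   Context: $D_n$ is the set of signed permutations $(\omega,\epsilon)$ ($\omega\in S_n$, $\epsilon\in\{-1,1\}^n$, $\omega(i)$ barred iff $\epsilon_i=-1$) with an even number of bars; $\epsilon'$ is $\epsilon$ with $\epsilon_1$ negated. $\omega(i)$ is a right-to-left maximum if $\omega(i)>\omega(j)$ for all $j>i$. Signed partitions: partitions of $\{0,\dots,n\}$ in which nonminimal elements of nonzero blocks (blocks not containing $0$) may be barred; the zero block has no bars. $\bar b$ toggles all bars of a block $b$, $\widetilde b$ removes them. $\Pi^B_n$ is ordered by $\pi\le\tau$ iff for each block $b$ of $\pi$, $b$ or $\bar b$ lies (as signed letters) in a nonzero block of $\tau$, or $\widetilde b$ lies in the zero block of $\tau$. $\Pi^D_n$ is the subposet of signed partitions whose zero block does not have size 2; it has minimum $\hat0$ and maximum $\hat1$, and $\overline{\Pi^D_n}=\Pi^D_n\setminus\{\hat0,\hat1\}$; homology is that of the order complex. Splitting $(\omega,\epsilon)$ at positions $i_1<\dots<i_k$ in $\{0,\dots,n-1\}$ ($i_{k+1}=n$; $k=0$ gives the one-block partition): zero block $\{0,\omega(1),\dots,\omega(i_1)\}$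 and for $j=1,\dots,k$ the nonzero block equal to whichever of $b_j=\{(\omega(i_j+1),\epsilon_{i_j+1}),\dots,(\omega(i_{j+1}),\epsilon_{i_{j+1}})\}$ or $\bar b_j$ has unbarred minimal element (where $(a,-1)=\bar a$, $(a,1)=a$). $\widetilde\Pi_{\omega,\epsilon}$ is the induced subposet of $\Pi^D_n$ of all signed partitions obtained by splitting $(\omega,\epsilon)$ or $(\omega,\epsilon')$ at all positions of a subset of $\{0,\dots,n-1\}$ whose smallest element is not $1$; it is isomorphic to the lattice of subsets of $[n]$, so the order complex of its proper part $\overline{\widetilde\Pi}_{\omega,\epsilon}$ is an $(n-2)$-sphere, with fundamental cycle (defined up to sign) $\widetilde\rho_{\omega,\epsilon}$. *)

(* Defs.v *)
From HB Require Import structures.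
From mathcomp Require Import all_boot all_order all_fingroup all_algebra.
From mathcomp Require Import boolp.

Set Implicit Arguments.
Unset Strict Implicit.
Unset Printing Implicit Defensive.

Import Order.TTheory GRing.Theory.

Local Open Scope ring_scope.

(* Subposets of T are sets A : {set T} with the induced order.  A simplicial
   chain is an integer function on {set T}; a face of dimension k is a set of
   cardinality k.+1, and the empty face (dimension -1) belongs to the complex,
   so the homology below is reduced. *)
Section OrderComplex.
Context {d : Order.disp_t} {T : finPOrderType d}.
Implicit Types (A B : {set T}) (c : {ffun {set T} -> int}).

Definition proper_part A : {set T} :=
  [set x in A | ~~ [forall y in A, (x <= y)%O] && ~~ [forall y in A, (y <= x)%O]].

Lemma proper_partS A B : A \subset B -> proper_part A \subset proper_part B.
Proof.
move=> /subsetP sAB; apply/subsetP => x; rewrite !inE => /and3P[xA xm xM].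
rewrite sAB //=; apply/andP; split.
- by apply: contra xm => /forall_inP h; apply/forall_inP => y /sAB /h.
- by apply: contra xM => /forall_inP h; apply/forall_inP => y /sAB /h.
Qed.

Definition order_complex A : {set {set T}} :=
  [set s : {set T} | (s \subset A) &&
                     [forall x in s, forall y in s, (x >=< y)%O]].

Definition is_chain A (m : nat) c : bool :=
  [forall s, (c s != 0) ==> ((s \in order_complex A) && (#|s| == m))].

(* On {x_0 < ... < x_k} this is the sum of (-1)^i times the face omitting x_i. *)
Definition boundary c : {ffun {set T} -> int} :=
  [ffun t : {set T} => \sum_(s : {set T}) \sum_(x in s | s :\ x == t)
              (-1) ^+ #|[set y in s | (y < x)%O]| * c s].

Lemma is_chain0 A m : is_chain A m 0.
Proof. by apply/forallP => s; rewrite ffunE eqxx. Qed.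

Lemma is_chainB A m c c' :
  is_chain A m c -> is_chain A m c' -> is_chain A m (c - c').
Proof.
move=> /forallP h /forallP h'; apply/forallP => s; apply/implyP.
rewrite !ffunE => nz; have [c0|cn] := eqVneq (c s) 0.
  apply: (implyP (h' s)); apply: contra nz => /eqP ->.
  by rewrite c0 subr0.
exact: (implyP (h s)).
Qed.

Lemma boundary0 : boundary 0 = 0.
Proof.
apply/ffunP => t; rewrite !ffunE big1 // => s _; rewrite big1 // => x _.
by rewrite ffunE mulr0.
Qed.

Lemma boundaryB c c' : boundary (c - c') = boundary c - boundary c'.
Proof.
apply/ffunP => t; rewrite !ffunE -sumrB; apply: eq_bigr => s _.
by rewrite -sumrB; apply: eq_bigr => x _; rewrite !ffunE mulrBr.
Qed.

Section Homology.
Variables (A : {set T}) (k : nat).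

Definition is_cycle : {pred {ffun {set T} -> int}} :=
  [pred c | is_chain A k.+1 c && (boundary c == 0)].

Fact is_cycle_zmod_closed : zmod_closed is_cycle.
Proof.
split=> [|c c']; rewrite !inE; first by rewrite is_chain0 boundary0 eqxx.
move=> /andP[h /eqP b] /andP[h' /eqP b'].
by rewrite is_chainB // boundaryB b b' subrr eqxx.
Qed.

HB.instance Definition _ :=
  GRing.isZmodClosed.Build {ffun {set T} -> int} is_cycle is_cycle_zmod_closed.

Record cycles : predArgType :=
  Cycle { cycle_chain :> {ffun {set T} -> int}; _ : cycle_chain \in is_cycle }.

HB.instance Definition _ := [isSub for cycle_chain].
HB.instance Definition _ := [Choice of cycles by <:].
HB.instance Definition _ := [SubChoice_isSubZmodule of cycles by <:].

(* Boundaries are cycles, so nothing is lost by taking this as a predicate on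
   cycles. *)
Definition is_boundary : {pred cycles} :=
  fun z => `[< exists2 c, is_chain A k.+2 c & boundary c = z :> {ffun _} >].

Fact is_boundary_zmod_closed : zmod_closed is_boundary.
Proof.
split=> [|z z' /asboolP[c hc ez] /asboolP[c' hc' ez']]; apply/asboolP.
  by exists 0; rewrite ?is_chain0 ?boundary0.
by exists (c - c'); rewrite ?is_chainB // boundaryB ez ez'.
Qed.

HB.instance Definition _ :=
  GRing.isZmodClosed.Build cycles is_boundary is_boundary_zmod_closed.

Definition homology : zmodType := Quotient.quot is_boundary.

Definition homology_class (z : cycles) : homology :=
  (\pi_(Quotient.quot is_boundary) z)%qT.

End Homology.

Lemma is_cycleS A B k c : A \subset B -> c \in is_cycle A k -> c \in is_cycle B k.
Proof.
rewrite !inE => sAB /andP[/forallP h ->]; rewrite andbT.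
apply/forallP => s; apply/implyP => /(implyP (h s)); rewrite !inE.
by move=> /andP[/andP[/subset_trans -> //]] -> ->.
Qed.

Definition cycle_incl A B k (sAB : A \subset B) (z : cycles A k) : cycles B k :=
  Cycle (is_cycleS sAB (valP z)).

End OrderComplex.

Definition Zbasis (V : zmodType) (I : finType) (e : I -> V) : Prop :=
  forall v : V, exists! a : {ffun I -> int}, v = \sum_i e i *~ a i.

(* For an order complex that is a k-sphere: a generator of its k-th reduced
   homology group, which is infinite cyclic.  As there is no face of dimension
   k+1, this determines the cycle z itself up to sign. *)
Definition fundamental_cycle d (T : finPOrderType d) (A : {set T}) (k : nat)
    (z : cycles A k) : Prop :=
  Zbasis (fun _ : unit => homology_class z).

Section SignedPartitions.
Variable n : nat.

(* The pair (a, true) is the barred letter, (a, false) the unbarred one. *)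
Definition letter : finType := ('I_n.+1 * bool)%type.
Implicit Types (b c : {set letter}) (x y : letter) (P : {set {set letter}}).

Definition zero_letter : letter := (ord0, false).

Definition bar b : {set letter} := [set (x.1, ~~ x.2) | x : letter in b].
Definition unbar b : {set letter} := [set (x.1, false) | x : letter in b].

Definition is_signed_partition P : bool :=
  [&& set0 \notin P, trivIset P,
      [forall i : 'I_n.+1,
         ((i, false) \in cover P) (+) ((i, true) \in cover P)]
    & [forall b in P, forall x in b, x.2 ==>
         ((zero_letter \notin b) && [exists y in b, (y.1 < x.1)%N])]].

Record signed_partition : predArgType :=
  SignedPartition { blocks :> {set {set letter}}; _ : is_signed_partition blocks }.

HB.instance Definition _ := [isSub for blocks].
HB.instance Definition _ := [Finite of signed_partition by <:].

Definition sp_le : rel signed_partition := fun p t =>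
  [forall b in blocks p, exists c in blocks t,
     if zero_letter \in c then unbar b \subset c
     else (b \subset c) || (bar b \subset c)].

Lemma in_bar b i s : ((i, s) \in bar b) = ((i, ~~ s) \in b).
Proof.
apply/imsetP/idP => [[[j r] jb [-> ->]]|ib]; first by rewrite negbK.
by exists (i, ~~ s); rewrite //= negbK.
Qed.

Lemma barK : involutive bar.
Proof. by move=> b; apply/setP => -[i s]; rewrite !in_bar negbK. Qed.

Lemma sp_uniq (p : signed_partition) b c i s s' :
  b \in blocks p -> c \in blocks p -> (i, s) \in b -> (i, s') \in c ->
  b = c /\ s = s'.
Proof.
case: p => P /= /and4P[_ /trivIsetP tP /forallP xP _] bP cP ib ic.
have ss : s = s'.
  have hs : (i, s) \in cover P by apply/bigcupP; exists b.
  have hs' : (i, s') \in cover P by apply/bigcupP; exists c.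
  by have := xP i; move: hs hs'; case: s s' {ib ic} => -[] // -> ->.
split=> //; apply/eqP/negPn/negP => /(tP _ _ bP cP) /disjoint_setI0 /setP/(_ (i, s)).
by rewrite !inE ib ss ic.
Qed.

Lemma sp_bars (p : signed_partition) b i :
  b \in blocks p -> (i, true) \in b ->
  zero_letter \notin b /\ exists2 y, y \in b & (y.1 < i)%N.
Proof.
case: p => P /= /and4P[_ _ _ /forall_inP h] /h /forall_inP {}h /h /=.
by case/andP => -> /exists_inP[y yb lt]; split=> //; exists y.
Qed.

Lemma sp_zero (p : signed_partition) b s :
  b \in blocks p -> (ord0, s) \in b -> zero_letter \in b.
Proof. by case: s => // bP /(sp_bars bP)[_ [y]]. Qed.

Lemma sp_min (p : signed_partition) b : b \in blocks p ->
  exists2 i, (i, false) \in b & forall y, y \in b -> (i <= y.1)%N.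
Proof.
move=> bP; have /set0Pn[x0 x0b] : b != set0.
  by apply: contraTneq bP => ->; case: p => P /= /and4P[].
case: (arg_minnP (fun x : letter => nat_of_ord x.1) x0b) => -[i s] ib mi.
exists i; last by move=> y /mi.
case: s ib mi => // /(sp_bars bP)[_ [y yb lt]] /(_ y yb) /=.
by rewrite leqNgt lt.
Qed.

Lemma sp_le_refl : reflexive sp_le.
Proof.
move=> p; apply/forall_inP => b bP; apply/exists_inP; exists b => //.
case: ifP => zb; last by rewrite subxx.
apply/subsetP => _ /imsetP[[i [] xb ->]] //=.
by have [] := sp_bars bP xb; rewrite zb.
Qed.

Lemma sp_leP p t : sp_le p t -> forall b, b \in blocks p ->
  exists2 c, c \in blocks t & [/\ forall i s, (i, s) \in b -> exists s', (i, s') \in c &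
    (if zero_letter \in c then unbar b \subset c
     else (b \subset c) || (bar b \subset c))].
Proof.
move=> /forall_inP h b /h /exists_inP[c cP hc]; exists c => //; split=> // i s ib.
move: hc; case: ifP => _.
  by move/subsetP=> hs; exists false; apply: hs; apply/imsetP; exists (i, s).
case/orP => /subsetP hs; first by exists s; apply: hs.
by exists (~~ s); apply: hs; rewrite in_bar negbK.
Qed.

Lemma sp_le_trans : transitive sp_le.
Proof.
move=> t p u /sp_leP h1 /sp_leP h2; apply/forall_inP => b /h1[c cP [bc hb]].
have [e eP [ce he]] := h2 c cP; apply/exists_inP; exists e => //.
move: he; case: ifP => ze he.
  apply/subsetP => _ /imsetP[[i s] /bc[s' ic] ->].
  by apply: (subsetP he); apply/imsetP; exists (i, s').
move: hb; case: ifP => zc hb.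
  by have [s /(sp_zero eP)] := ce _ _ zc; rewrite ze.
have barS (f g : {set letter}) : f \subset g -> bar f \subset bar g.
  by move=> /subsetP s; apply/subsetP => -[i s']; rewrite !in_bar => /s.
case/orP: hb => hb; case/orP: he => he.
- by rewrite (subset_trans hb he).
- by rewrite (subset_trans (barS _ _ hb) he) orbT.
- by rewrite (subset_trans hb he) orbT.
- by rewrite -[b]barK (subset_trans (barS _ _ hb) he).
Qed.

Lemma sp_le_anti : antisymmetric sp_le.
Proof.
suff sub p t : sp_le p t -> sp_le t p -> blocks p \subset blocks t.
  move=> p t /andP[pt tp]; apply: val_inj; apply/eqP.
  by rewrite eqEsubset !sub.
move=> /sp_leP h1 /sp_leP h2; apply/subsetP => b bP.
have [c cP [bc hb]] := h1 b bP; have [b' bP' [cb hc]] := h2 c cP.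
have [i ib mi] := sp_min bP.
have [s' ic] := bc _ _ ib; have [s'' ib'] := cb _ _ ic.
have [ebb _] := sp_uniq bP bP' ib ib'; subst b'.
suff -> : b = c by [].
suff sbc : b \subset c.
  apply/eqP; rewrite eqEsubset sbc; apply/subsetP => -[j s] jc.
  have [r jb] := cb _ _ jc.
  by have [_ ->] := sp_uniq cP cP jc (subsetP sbc _ jb).
move: hb; case: ifP => zc.
  have [s0 /(sp_zero bP) zb] := cb _ _ zc.
  move=> /subsetP h; apply/subsetP => -[j [] jb].
    by have [] := sp_bars bP jb; rewrite zb.
  by apply: h; apply/imsetP; exists (j, false).
case/orP => // /subsetP h.
have /(sp_bars cP)[_ [[j s] jc lt]] : (i, true) \in c by apply: h; rewrite in_bar.
by have [r /mi] := cb _ _ jc; rewrite leqNgt lt.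
Qed.

Fact signed_partition_display : Order.disp_t.
Proof. exact: (Order.Disp tt tt). Qed.

HB.instance Definition _ :=
  Order.Le_isPOrder.Build signed_partition_display signed_partition
    sp_le_refl sp_le_anti sp_le_trans.

Definition PiD : {set signed_partition} :=
  [set p : signed_partition | [forall b in blocks p, (zero_letter \in b) ==> (#|b| != 2%N)]].

(* Below, 'I_n encodes {1, ..., n} with a shift by one, both for the
   positions and for the values of a permutation; e i = true iff the letter at
   position i is barred. *)
Implicit Types (w : 'S_n) (e : {ffun 'I_n -> bool}) (S : {set 'I_n}).

Definition sgn_letter w e (q : 'I_n) : letter := (lift ord0 (w q), e q).

(* The splitting positions i_1 < ... < i_k are the elements of S, unshifted.
   With a position p encoded as q = p - 1, the range p <= i_1 reads q < i_1 and
   the range i_j + 1 <= p <= i_(j+1) reads i_j <= q < i_(j+1). *)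
Definition split_zero_block w S : {set letter} :=
  zero_letter |: [set (lift ord0 (w q), false) | q : 'I_n & [forall i in S, (q < i)%N]].

Definition split_block w e S (i : 'I_n) : {set letter} :=
  [set sgn_letter w e q | q : 'I_n &
     (i <= q)%N && [forall j in S, (i < j)%N ==> (q < j)%N]].

Definition min_unbarred b : bool :=
  [exists x in b, ~~ x.2 && [forall y in b, (x.1 <= y.1)%N]].

Definition normalize b : {set letter} := if min_unbarred b then b else bar b.

Definition split_blocks w e S : {set {set letter}} :=
  split_zero_block w S |: [set normalize (split_block w e S i) | i in S].

Lemma sgn_letter_pos w e e' q q' :
  (sgn_letter w e q).1 = (sgn_letter w e' q').1 -> q = q'.
Proof. by move=> /lift_inj /perm_inj. Qed.

Lemma in_normalize w e S i x : x \in normalize (split_block w e S i) ->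
  exists q : 'I_n, [/\ (i <= q)%N, forall j, j \in S -> (i < j)%N -> (q < j)%N &
    x.1 = lift ord0 (w q)].
Proof.
have aux r : (x.1, r) \in split_block w e S i -> exists q : 'I_n,
    [/\ (i <= q)%N, forall j, j \in S -> (i < j)%N -> (q < j)%N & x.1 = lift ord0 (w q)].
  case/imsetP=> q; rewrite !inE => /andP[iq /forall_inP h] [-> _].
  by exists q; split=> // j /h /implyP.
rewrite /normalize; case: ifP => _; case: x aux => j s aux; first exact: aux.
by rewrite in_bar; apply: aux.
Qed.

Lemma in_zero_block w S x : x \in split_zero_block w S ->
  x = zero_letter \/
  exists2 q : 'I_n, (forall i, i \in S -> (q < i)%N) & x = (lift ord0 (w q), false).
Proof.
rewrite !inE => /orP[/eqP|/imsetP[q]]; first by left.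
by rewrite !inE => /forall_inP h ->; right; exists q.
Qed.

Lemma split_block_sgn w e S i a r s :
  (a, r) \in split_block w e S i -> (a, s) \in split_block w e S i -> r = s.
Proof.
case/imsetP=> q _ E /imsetP[q' _ E'].
have qq : q = q'.
  by apply: (@sgn_letter_pos w e e); rewrite -(congr1 fst E) -(congr1 fst E').
by rewrite (congr1 snd E : r = e q) (congr1 snd E' : s = e q') qq.
Qed.

Lemma normalize_sgn w e S i a r s : (a, r) \in normalize (split_block w e S i) ->
  (a, s) \in normalize (split_block w e S i) -> r = s.
Proof.
rewrite /normalize; case: ifP => _; first exact: split_block_sgn.
by rewrite !in_bar => h h'; apply: negb_inj; apply: split_block_sgn h h'.
Qed.

Lemma split_blocks_uniq w e S b c a r s :
  b \in split_blocks w e S -> c \in split_blocks w e S ->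
  (a, r) \in b -> (a, s) \in c -> b = c /\ r = s.
Proof.
have lift0 (v : 'I_n) : lift ord0 v <> ord0 by [].
have zn i a' r' s' : i \in S -> (a', r') \in split_zero_block w S ->
    (a', s') \in normalize (split_block w e S i) -> False.
  move=> iS /in_zero_block[[-> _]|[q qS [-> _]]] /in_normalize[q' [iq' _ /= E]].
    by have := lift0 (w q'); rewrite -E.
  have /perm_inj eqq := lift_inj E; have := qS _ iS.
  by rewrite eqq ltnNge iq'.
rewrite !inE => /orP[/eqP->|/imsetP[i iS ->]] /orP[/eqP->|/imsetP[j jS ->]] h h'.
- split=> //.
  have f x : x \in split_zero_block w S -> x.2 = false.
    by move=> /in_zero_block[->|[q _ ->]].
  by rewrite (f _ h : r = _) (f _ h' : s = _).
- by have := zn _ _ _ _ jS h h'.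
- by have := zn _ _ _ _ iS h' h.
suff eij : i = j by subst j; split=> //; apply: normalize_sgn h h'.
have [q [iq qS E]] := in_normalize h; have [q' [jq' qS' E']] := in_normalize h'.
have /perm_inj eqq := lift_inj (etrans (esym E) E'); subst q'.
apply/val_inj/eqP; rewrite eqn_leq.
rewrite leqNgt; apply/andP; split.
  by apply/negP => /(qS' _ iS); rewrite ltnNge iq.
by rewrite leqNgt; apply/negP => /(qS _ jS); rewrite ltnNge jq'.
Qed.

Lemma split_blocks_cover w e S a :
  exists2 b, b \in split_blocks w e S & exists s, (a, s) \in b.
Proof.
case: (unliftP ord0 a) => [v ->|->]; last first.
  by exists (split_zero_block w S); [rewrite setU11|exists false; rewrite setU11].
set q := (w^-1)%g v; have -> : v = w q by rewrite permKV.
have [/existsP[i0 /andP[i0S i0q]]|/existsPn none] := boolP [exists i, (i \in S) && (i <= q)%N].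
  have P0 : [pred i : 'I_n | (i \in S) && (i <= q)%N] i0 by rewrite /= i0S.
  case: (arg_maxnP (fun i : 'I_n => nat_of_ord i) P0) => /= i /andP[iS iq] mi.
  exists (normalize (split_block w e S i)).
    by rewrite inE; apply/orP; right; apply: imset_f.
  have qb : sgn_letter w e q \in split_block w e S i.
    apply: imset_f; rewrite !inE iq; apply/forall_inP => j jS; apply/implyP.
    apply: contraTltn => jq; rewrite -leqNgt; apply: mi.
    by rewrite jS.
  rewrite /normalize; case: ifP => _; first by exists (e q).
  by exists (~~ e q); rewrite in_bar negbK.
exists (split_zero_block w S); first by rewrite setU11.
exists false; rewrite inE; apply/orP; right; apply/imsetP; exists q => //.
rewrite !inE; apply/forall_inP => i iS; have := none i.
by rewrite iS /= -ltnNge.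
Qed.

Lemma split_blocksP w e S : is_signed_partition (split_blocks w e S).
Proof.
apply/and4P; split.
- rewrite !inE; apply/norP; split.
    by apply/eqP => /setP/(_ zero_letter); rewrite !inE eqxx.
  apply/imsetP => -[i iS /esym E]; have : sgn_letter w e i \in split_block w e S i.
    by apply: imset_f; rewrite !inE leqnn; apply/forall_inP => j _; apply/implyP.
  move: E; rewrite /normalize; case: ifP => _ /setP E; first by rewrite E inE.
  by have := E ((sgn_letter w e i).1, ~~ e i); rewrite in_bar negbK inE => ->.
- apply/trivIsetP => b c bP cP; apply: contraNT => /pred0Pn[[a s] /andP[/= ab ac]].
  by have [->] := split_blocks_uniq bP cP ab ac.
- apply/forallP => a; have [b bP [s ab]] := split_blocks_cover w e S a.
  have h1 : (a, s) \in cover (split_blocks w e S) by apply/bigcupP; exists b.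
  have h2 : (a, ~~ s) \notin cover (split_blocks w e S).
    apply/bigcupP => -[c cP ac]; have [_] := split_blocks_uniq bP cP ab ac.
    by case: (s).
  by case: s {ab} h1 h2 => /= -> /negbTE ->.
apply/forall_inP => b bP; apply/forall_inP => -[a []] //= ab.
move: bP; rewrite !inE => /orP[/eqP E|/imsetP[i iS E]].
  by subst b; case/in_zero_block: ab => [//|[q _ //]].
subst b; apply/andP; split.
  by apply/negP => /in_normalize[q [_ _ /= E]]; have := neq_lift ord0 (w q); rewrite -E eqxx.
move: ab; rewrite /normalize; case: ifP => mb ab.
  case/exists_inP: mb => -[m s] mb /andP[/= /negbTE sF /forall_inP mm]; subst s.
  apply/exists_inP; exists (m, false) => //=.
  rewrite ltn_neqAle (mm _ ab) andbT; apply/eqP => /val_inj E; subst m.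
  by have := split_block_sgn ab mb.
rewrite in_bar /= in ab.
case: (arg_minnP (fun x : letter => nat_of_ord x.1) ab) => -[m s] mB mm.
case: s mB mm => mB mm.
  apply/exists_inP; exists (m, false); first by rewrite in_bar.
  rewrite ltn_neqAle (mm _ ab) andbT; apply/eqP => /val_inj E; rewrite /= in E; subst m.
  by have := split_block_sgn ab mB.
suff: min_unbarred (split_block w e S i) by rewrite mb.
apply/exists_inP; exists (m, false) => //=.
by apply/forall_inP => y yB; apply: (mm y).
Qed.

Definition splitting w e S : signed_partition := SignedPartition (split_blocksP w e S).

Definition negate_first e : {ffun 'I_n -> bool} :=
  [ffun i : 'I_n => (nat_of_ord i == 0%N) (+) e i].

(* The smallest element of S, if S is nonempty, is not 1. *)
Definition admissible S : bool :=
  [forall i in S, [forall j in S, (i <= j)%N] ==> (nat_of_ord i != 1%N)].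

Definition tPi w e : {set signed_partition} :=
  [set p in PiD | [exists S : {set 'I_n}, admissible S &&
                    ((p == splitting w e S) || (p == splitting w (negate_first e) S))]].

Lemma tPi_sub w e : tPi w e \subset PiD.
Proof. by apply/subsetP => p; rewrite inE => /andP[]. Qed.

Record Dn : predArgType :=
  DnElt { Dn_pair :> 'S_n * {ffun 'I_n -> bool};
          _ : ~~ odd #|[set i | Dn_pair.2 i]| }.

HB.instance Definition _ := [isSub for Dn_pair].
HB.instance Definition _ := [Finite of Dn by <:].

Definition rtl_max w (i : 'I_n) : bool :=
  [forall j : 'I_n, (i < j)%N ==> (w j < w i)%N].

(* With the shift by one, omega(1) <> n says that position 0 is not sent to n-1. *)
Definition basis_index (x : Dn) : bool :=
  [forall i : 'I_n, (nat_of_ord i == 0%N) ==> (nat_of_ord (x.1 i) != n.-1)] &&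
  [forall i : 'I_n, rtl_max x.1 i ==> ~~ x.2 i].

End SignedPartitions.

(* Main.v *)
From HB Require Import structures.
Require Import Defs.
From mathcomp Require Import all_boot all_order all_fingroup all_algebra.
From mathcomp Require Import boolp zify.

(** The homology is top-dimensional, so it is the group of cycles, and a cycle
    is a function on maximal flags [F 0 < ... < F n] satisfying one linear
    relation for each flag with a step removed.

    Read flags from the bottom up and call a step idle if it does not change the
    block of the largest letter outside the zero block.  In an interval of rank
    two at most one element leaves that block unchanged, so the relations express
    the value of a cycle on any flag through its values on flags without idle
    steps.  Such a flag is the flag [m_x] of a signed permutation [x = (w, e)]
    whose right-to-left maxima are unbarred, with [w(1) <> n]: cut [w] after each
    right-to-left maximum and remove the cuts segment by segment, from right to
    left in each segment.  The relation at the step where [n] is about to enter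
    the zero block pairs [e] with [e'] up to flags where [n] enters earlier, so
    the flags [m_x] with [x] in [D_n] determine a cycle.

    Conversely the coefficient of [m_x] in [rho_x] is [1] or [-1], since any
    divisor of it divides all coefficients of [rho_x], by the same exchange of
    flags in the Boolean lattice.  If [m_y] lies in the support of [rho_x] then
    the sum over [i] of [max_(q >= i) w(q)] is at most as large for [x] as for
    [y], with equality only if [x = y]: the matrix of the coefficients of [m_y]
    in [rho_x] is unitriangular. *)

Set Implicit Arguments.
Unset Strict Implicit.
Unset Printing Implicit Defensive.

Import Order.TTheory GRing.Theory Num.Theory.

Local Open Scope nat_scope.

(** * Bases of free abelian groups *)

Section Zbases.
Local Open Scope ring_scope.

Section UnitriangularSystem.
Variables (I : finType) (M : I -> I -> int) (weight : I -> nat).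
Hypothesis M_diag : forall i, `|M i i|%N = 1%N.
Hypothesis M_triangular : forall i j, i != j -> M i j != 0 -> (weight i < weight j)%N.

Lemma unit_diag_sqr i : M i i * M i i = 1.
Proof. by have := M_diag i; nia. Qed.

Lemma unitriangular_inj (a : I -> int) :
  (forall j, \sum_i a i * M i j = 0) -> forall i, a i = 0.
Proof.
move=> a0 j; have [m] := ubnP (weight j); elim: m j => // m IH j; rewrite ltnS => jm.
have := a0 j; rewrite (bigD1 j) //= big1 ?addr0 => [|i ij].
  by move=> /(congr1 ( *%R^~ (M j j))); rewrite -mulrA unit_diag_sqr mulr1 mul0r.
have [->|nz] := eqVneq (M i j) 0; first by rewrite mulr0.
by rewrite IH ?mul0r //; apply: leq_trans jm; apply: M_triangular.
Qed.

Lemma unitriangular_surj (b : I -> int) :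
  exists a : {ffun I -> int}, forall j, \sum_i a i * M i j = b j.
Proof.
suff solve m : exists a : {ffun I -> int},
    forall j, (weight j < m)%N -> \sum_i a i * M i j = b j.
  have [a aP] := solve (\max_i weight i).+1; exists a => j; apply: aP.
  by rewrite ltnS; apply: leq_bigmax.
elim: m => [|m [a aP]]; first by exists [ffun=> 0].
pose err j := b j - \sum_i a i * M i j.
pose correction i := if weight i == m then err i * M i i else 0.
exists [ffun i => a i + correction i] => j.
under eq_bigr do rewrite ffunE mulrDl.
rewrite big_split /= ltnS leq_eqVlt => jm.
have off_diag i : i != j -> correction i * M i j = 0.
  rewrite /correction => ij; case: eqP => [im|_]; last by rewrite mul0r.
  have [->|/(M_triangular ij)] := eqVneq (M i j) 0; first by rewrite mulr0.
  by rewrite im; move: jm; lia.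
rewrite [X in _ + X](bigD1 j) //= [X in _ + (_ + X)]big1 // addr0 /correction.
have [_|jm'] := eqVneq (weight j) m.
  by rewrite -mulrA unit_diag_sqr mulr1 addrC subrK.
by rewrite mul0r addr0 aP //; move: jm; rewrite (negbTE jm').
Qed.

End UnitriangularSystem.

Lemma unitriangular_Zbasis (V : zmodType) (I : finType) (e : I -> V)
    (coord : I -> {additive V -> int}) (weight : I -> nat) :
  (forall v, (forall i, coord i v = 0) -> v = 0) ->
  (forall i, `|coord i (e i)|%N = 1%N) ->
  (forall i j, i != j -> coord j (e i) != 0 -> (weight i < weight j)%N) ->
  Zbasis e.
Proof.
move=> coord_inj diag tri v; pose M i j := coord j (e i).
have coord_comb (a : {ffun I -> int}) j :
    coord j (\sum_i e i *~ a i) = \sum_i a i * M i j.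
  by rewrite raddf_sum; apply: eq_bigr => i _; rewrite raddfMz -mulrzr intz mulrC.
have [a aP] := unitriangular_surj (M := M) diag tri (fun j => coord j v).
exists a; split=> [|b vb].
  apply/eqP; rewrite -subr_eq0; apply/eqP/coord_inj => j.
  by rewrite raddfB coord_comb aP subrr.
apply/ffunP => i; apply/eqP; rewrite -subr_eq0; apply/eqP.
apply: (unitriangular_inj (M := M) diag tri (a := fun i => a i - b i)) => j.
by under eq_bigr do rewrite mulrBl; rewrite sumrB aP vb coord_comb subrr.
Qed.

Lemma Zbasis_bij (V W : zmodType) (I : finType) (h : {additive V -> W}) (e : I -> V) :
  bijective h -> Zbasis e -> Zbasis (fun i => h (e i)).
Proof.
move=> [g gK hK] basis_e w; have [a [ga uniq_a]] := basis_e (g w).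
have h_comb (b : {ffun I -> int}) : \sum_i h (e i) *~ b i = h (\sum_i e i *~ b i).
  by rewrite raddf_sum; apply: eq_bigr => i _; rewrite raddfMz.
exists a; split=> [|b]; first by rewrite h_comb -ga hK.
by rewrite h_comb => wb; apply: uniq_a; rewrite wb gK.
Qed.

End Zbases.

(** * Cycles and homology classes *)

Section Homology.
Local Open Scope ring_scope.
Context {d : Order.disp_t} {T : finPOrderType d}.
Variables (A : {set T}) (k : nat).
Implicit Types (z : cycles A k) (s : {set T}).

Lemma cycle_is_chain z : is_chain A k.+1 z.
Proof. by case: z => c /= /andP[]. Qed.

Lemma cycle_boundary z : boundary z = 0.
Proof. by case: z => c /= /andP[_ /eqP]. Qed.

Definition cycle_coef s z : int := z s.

Fact cycle_coef_is_zmod_morphism s : zmod_morphism (cycle_coef s).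
Proof.
by move=> z z'; rewrite /cycle_coef -[cycle_chain (z - z')]/(\val _) raddfB !ffunE.
Qed.

HB.instance Definition _ s :=
  GRing.isZmodMorphism.Build (cycles A k) int (cycle_coef s)
    (cycle_coef_is_zmod_morphism s).

Lemma cycle_ext z z' : (forall s, z s = z' s) -> z = z'.
Proof. by move=> E; apply/val_inj/ffunP. Qed.

Lemma homology_class_bij :
  (forall s, s \in order_complex A -> (#|s| <= k.+1)%N) ->
  bijective (@homology_class _ _ A k).
Proof.
move=> dimA; exists generic_quotient.repr; last exact: generic_quotient.reprK.
move=> z; have /eqP := generic_quotient.reprK (homology_class z).
rewrite /homology_class -Quotient.idealrBE => /asboolP[c chain_c bd_c].
suff c0 : c = 0.
  apply/eqP; rewrite -subr_eq0; apply/eqP/val_inj; apply: etrans (esym bd_c) _.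
  by rewrite c0 boundary0.
apply/ffunP => s; rewrite ffunE; apply/eqP/negPn/negP.
by case/(implyP (forallP chain_c s))/andP=> /dimA/[swap]/eqP->; rewrite ltnn.
Qed.

Lemma Zbasis_homology (I : finType) (z_ : I -> cycles A k) :
  (forall s, s \in order_complex A -> (#|s| <= k.+1)%N) ->
  Zbasis z_ -> Zbasis (fun i => homology_class (z_ i)).
Proof.
by move/homology_class_bij/(Zbasis_bij (h := \pi_(Quotient.quot _)%qT)); apply.
Qed.

Lemma boundary_scale (D : int) (c : {ffun {set T} -> int}) :
  boundary [ffun s => D * c s] = [ffun t => D * boundary c t].
Proof.
apply/ffunP => t; rewrite !ffunE mulr_sumr; apply: eq_bigr => s _.
by rewrite mulr_sumr; apply: eq_bigr => x _; rewrite ffunE mulrCA.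
Qed.

Lemma cycle_divisible (D : int) z :
  (forall s, (D %| z s)%Z) -> exists z', z = z' *~ D.
Proof.
have [-> dvd0|D0 dvdD] := eqVneq D 0.
  exists 0; apply: cycle_ext => s; rewrite mulr0z -[RHS]/(cycle_coef s 0) raddf0.
  by apply/eqP; rewrite -dvd0z.
pose c : {ffun {set T} -> int} := [ffun s => (z s %/ D)%Z].
have zc : z = [ffun s => D * c s] :> {ffun _ -> _}.
  by apply/ffunP => s; rewrite !ffunE mulrC divzK.
have c_cycle : c \in is_cycle A k.
  rewrite inE; apply/andP; split.
    apply/forallP => s; apply/implyP => cs.
    apply: (implyP (forallP (cycle_is_chain z) s)).
    by apply: contra cs => /eqP zs; rewrite ffunE zs div0z.
  apply/eqP/ffunP => t; have /ffunP/(_ t)/eqP := cycle_boundary z.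
  by rewrite zc boundary_scale !ffunE mulf_eq0 (negbTE D0) => /eqP.
exists (Cycle c_cycle); apply: cycle_ext => s.
by rewrite -[RHS]/(cycle_coef s _) raddfMz /cycle_coef /= zc ffunE -mulrzr intz mulrC.
Qed.

Lemma fundamental_cycle_primitive (D : int) z :
  fundamental_cycle z -> (forall s, (D %| z s)%Z) -> `|D|%N = 1%N.
Proof.
move=> fund /cycle_divisible[z' zz'].
pose h : {additive cycles A k -> homology A k} := \pi_(Quotient.quot _)%qT.
have [a [z'a _]] := fund (h z').
have zE : h z = h z *~ (a tt * D).
  by rewrite {1}zz' raddfMz z'a (big_pred1 tt) ?mulrzA //; case.
have [b [_ uniq_b]] := fund (h z).
have bE : b = [ffun=> 1].
  by apply: uniq_b; rewrite (big_pred1 tt) ?ffunE ?mulr1z //; case.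
have : b = [ffun=> a tt * D].
  by apply: uniq_b; rewrite (big_pred1 tt) ?ffunE //; case.
rewrite bE => /ffunP/(_ tt); rewrite !ffunE.
by move/(congr1 absz); rewrite abszM => /esym/eqP; rewrite muln_eq1 => /andP[_ /eqP].
Qed.

End Homology.

(** * Maximal flags of a graded poset *)

Section Flags.
Context {d : Order.disp_t} {T : finPOrderType d}.
Variables (B : {set T}) (n : nat) (rk : T -> nat) (bot top : T).
Implicit Types (F : nat -> T) (A : {set T}) (j k : nat) (p q x : T).

Definition flag F : Prop :=
  [/\ forall k, k <= n -> F k \in B, forall k, k < n -> (F k < F k.+1)%O,
      F 0 = bot & F n = top].

(* The end points [F 0] and [F n] do not belong to the proper part. *)
Definition facet F : {set T} := [set F k | k : 'I_n & 0 < k].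

Definition update F j q : nat -> T := fun k => if k == j then q else F k.

Record graded : Prop := Graded {
  graded_homo : {homo rk : p q / (p < q)%O >-> p < q};
  graded_bot : [/\ bot \in B, {in B, forall p, (bot <= p)%O} & rk bot = 0];
  graded_top : [/\ top \in B, {in B, forall p, (p <= top)%O} & rk top = n] }.

Lemma update_same F j q : update F j q j = q.
Proof. by rewrite /update eqxx. Qed.

Lemma update_other F j q k : k != j -> update F j q k = F k.
Proof. by rewrite /update => /negbTE->. Qed.

Lemma update_id F j : update F j (F j) = F.
Proof. by apply/funext => k; rewrite /update; case: eqP => // ->. Qed.

Lemma eq_facet F G : (forall k, k <= n -> F k = G k) -> facet F = facet G.
Proof. by move=> E; apply: eq_imset => k; apply/E/ltnW. Qed.

Lemma facetP F x : reflect (exists2 k, 0 < k < n & x = F k) (x \in facet F).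
Proof.
apply: (iffP imsetP) => [[k]|[k /andP[k0 kn] ->]].
  by rewrite inE => k0 ->; exists k; rewrite ?k0 /=.
by exists (Ordinal kn); rewrite ?inE.
Qed.

Lemma flag_lt F j k : flag F -> j < k <= n -> (F j < F k)%O.
Proof.
case=> _ ltF _ _; elim: k => // k IH; rewrite ltnS => /andP[+ kn].
rewrite leq_eqVlt => /predU1P[->|jk]; first exact: ltF.
by apply: lt_trans (ltF k kn); apply: IH; rewrite jk ltnW.
Qed.

Lemma flag_le F j k : flag F -> j <= k <= n -> (F j <= F k)%O.
Proof.
move=> flF /andP[+ kn]; rewrite leq_eqVlt => /predU1P[->|jk]; first by rewrite lexx.
by apply/ltW/flag_lt; rewrite ?jk.
Qed.

Lemma flag_update F j q : flag F -> 0 < j < n -> q \in B ->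
  (F j.-1 < q < F j.+1)%O -> flag (update F j q).
Proof.
move=> [inB ltF F0 Fn] jn qB /andP[lq ql]; rewrite /update; split.
- by move=> k lkn; case: ifP => // _; apply: inB.
- move=> k lkn; case: eqP => [->|kj]; case: eqP => [E|k1j]; rewrite ?ltF //.
  + lia.
  + by move: lq; rewrite -E.
- by rewrite ifN //; lia.
- by rewrite ifN //; lia.
Qed.

Hypothesis gr : graded.

Lemma graded_lt_comparable p q : (p >=< q)%O -> rk p < rk q -> (p < q)%O.
Proof.
case/orP; rewrite le_eqVlt => /predU1P[->|/(graded_homo gr) lt] //.
- by rewrite ltnn.
- by rewrite ltnn.
by rewrite ltnNge ltnW.
Qed.

Lemma flag_rank F k : flag F -> k <= n -> rk (F k) = k.
Proof.
move=> flF kn; have [_ ltF F0 Fn] := flF.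
have lower j : j <= n -> j <= rk (F j).
  elim: j => // j IH jn; apply: leq_ltn_trans (IH (ltnW jn)) _.
  exact/(graded_homo gr)/ltF.
have upper j : j <= n -> rk (F (n - j)) + j <= n.
  have [_ _ rk_top] := graded_top gr.
  elim: j => [_|j IH jn]; first by rewrite subn0 Fn rk_top addn0.
  apply: leq_trans (IH (ltnW jn)); rewrite addnS -addSn leq_add2r -(subnSK jn).
  by apply/(graded_homo gr)/ltF; rewrite ltn_subrL; lia.
by have := lower k kn; have := upper (n - k) (leq_subr _ _); rewrite subKn //; lia.
Qed.

Lemma flag_inj F j k : flag F -> j <= n -> k <= n -> F j = F k -> j = k.
Proof. by move=> flF jn kn /(congr1 rk); rewrite !flag_rank. Qed.

Lemma flag_between F k : flag F -> 0 < k < n -> F k \in B /\ (F k.-1 < F k < F k.+1)%O.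
Proof.
move=> flF kn; have [inB _ _ _] := flF; split; first by apply: inB; lia.
by rewrite !flag_lt //; lia.
Qed.

Lemma proper_partE p : (p \in proper_part B) = [&& p \in B, p != bot & p != top].
Proof.
have [[botB bot_le _] [topB le_top _]] := (graded_bot gr, graded_top gr).
rewrite inE; case pB: (p \in B) => //=; congr (~~ _ && ~~ _).
  apply/forall_inP/eqP => [le_p|-> q]; last exact: bot_le.
  by apply/le_anti; rewrite le_p // bot_le.
apply/forall_inP/eqP => [le_p|-> q]; last exact: le_top.
by apply/le_anti; rewrite le_p // le_top.
Qed.

Lemma proper_part_rank p : p \in proper_part B -> 0 < rk p < n.
Proof.
have [[_ bot_le rk_bot] [_ le_top rk_top]] := (graded_bot gr, graded_top gr).
rewrite proper_partE => /and3P[pB pb pt].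
have /(graded_homo gr) : (bot < p)%O by rewrite lt_neqAle eq_sym pb bot_le.
have /(graded_homo gr) : (p < top)%O by rewrite lt_neqAle pt le_top.
by rewrite rk_bot rk_top => -> ->.
Qed.

Section Chain.
Variable A : {set T}.
Hypothesis chainA : A \in order_complex (proper_part B).

Lemma chain_proper x : x \in A -> x \in proper_part B.
Proof. by move: x; apply/subsetP; move: chainA; rewrite inE => /andP[]. Qed.

Lemma chain_comparable x y :
  x \in bot |: (top |: A) -> y \in bot |: (top |: A) -> (x >=< y)%O.
Proof.
have [[botB bot_le _] [topB le_top _]] := (graded_bot gr, graded_top gr).
move=> xA yA; have inB q : q \in bot |: (top |: A) -> q \in B.
  rewrite !inE => /or3P[/eqP->|/eqP->|/chain_proper] //.
  by rewrite proper_partE => /and3P[].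
have := inB _ xA; have := inB _ yA; move: xA yA; rewrite !inE /Order.comparable.
case/or3P=> [/eqP->|/eqP->|xA].
- by move=> _ /bot_le->.
- by move=> _ /le_top->; rewrite orbT.
case/or3P=> [/eqP->|/eqP->|yA].
- by move=> _ /bot_le->; rewrite orbT.
- by move=> _ /le_top->.
move: chainA; rewrite inE => /andP[_ /forall_inP/(_ x xA)/forall_inP/(_ y yA)].
by rewrite /Order.comparable => ->.
Qed.

Lemma chain_rank_inj : {in A &, injective rk}.
Proof.
move=> x y xA yA E; have : (x >=< y)%O.
  by apply: chain_comparable; rewrite !inE ?xA ?yA !orbT.
by case: comparableP => // /(graded_homo gr); rewrite E ltnn.
Qed.

Lemma chain_ranks :
  uniq [seq rk x | x in A] /\ {subset [seq rk x | x in A] <= iota 1 n.-1}.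
Proof.
split.
  rewrite map_inj_in_uniq ?enum_uniq // => x y.
  by rewrite !mem_enum; apply: chain_rank_inj.
move=> _ /imageP[x /chain_proper/proper_part_rank rx ->]; rewrite mem_iota; lia.
Qed.

Lemma card_chain : #|A| <= n.-1.
Proof.
have [uniq_rk sub_rk] := chain_ranks.
by have := uniq_leq_size uniq_rk sub_rk; rewrite size_image size_iota.
Qed.

Lemma maximal_chain_rank k :
  #|A| = n.-1 -> 0 < k < n -> exists2 x, x \in A & rk x = k.
Proof.
move=> cardA kn; have [uniq_rk sub_rk] := chain_ranks.
have [|_ ranks] := uniq_min_size uniq_rk sub_rk.
  by rewrite size_image size_iota cardA.
have : k \in iota 1 n.-1 by rewrite mem_iota; lia.
by rewrite -ranks => /imageP[x xA ->]; exists x.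
Qed.

Lemma maximal_chain_flag : 0 < n -> #|A| = n.-1 -> exists2 F, flag F & A = facet F.
Proof.
move=> n_gt0 cardA.
have [[botB _ rk_bot] [topB _ rk_top]] := (graded_bot gr, graded_top gr).
pose F k := if k == 0 then bot else if k == n then top
            else odflt bot [pick x in A | rk x == k].
have Fbot : F 0 = bot by [].
have Ftop : F n = top by rewrite /F eqxx ifN // -lt0n.
have Fmid k : 0 < k < n -> F k \in A /\ rk (F k) = k.
  move=> kn; rewrite /F !ifN; [|lia..]; case: pickP => [x /andP[xA /eqP]//|none].
  have [x xA rx] := maximal_chain_rank cardA kn.
  by have := none x; rewrite xA rx eqxx.
have FA k : k <= n -> F k \in bot |: (top |: A) /\ rk (F k) = k.
  have [->|k0] := eqVneq k 0; first by rewrite Fbot !inE eqxx.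
  have [->|kn] := eqVneq k n; first by rewrite Ftop !inE eqxx orbT.
  by move=> lekn; have [|FkA rkF] := Fmid k; [lia|rewrite !inE FkA !orbT].
exists F; last first.
  apply/setP => x; apply/idP/facetP => [xA|[k /Fmid[FkA _] ->] //].
  have rx := proper_part_rank (chain_proper xA); have [FxA E] := Fmid _ rx.
  by exists (rk x) => //; apply: chain_rank_inj.
split=> // k kn.
  have [+ _] := FA k kn; rewrite !inE => /or3P[/eqP->|/eqP->|/chain_proper] //.
  by rewrite proper_partE => /and3P[].
have [FkA rkF] := FA k (ltnW kn); have [FkA' rkF'] := FA k.+1 kn.
by apply: graded_lt_comparable (chain_comparable FkA FkA') _; rewrite rkF rkF'.
Qed.

End Chain.

Section FlagRelation.
Variables (F : nat -> T) (j : nat).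
Hypotheses (flF : flag F) (jn : 0 < j < n).

Lemma facet_update q : facet (update F j q) = q |: (facet F :\ F j).
Proof.
apply/setP => x; rewrite !inE; apply/facetP/orP.
  case=> k kn ->; have [->|kj] := eqVneq k j; first by rewrite update_same; left.
  rewrite update_other //; right; apply/andP; split; last by apply/facetP; exists k.
  by apply: contra kj => /eqP/(flag_inj flF)->; lia.
case=> [/eqP->|/andP[xj /facetP[k kn E]]]; first by exists j; rewrite ?update_same.
by exists k => //; rewrite update_other //; apply: contraNneq xj => <-; rewrite E.
Qed.

Lemma card_facet_below : #|[set x in facet F | (x < F j)%O]| = j.-1.
Proof.
have -> : [set x in facet F | (x < F j)%O] = [set F k.+1 | k : 'I_j.-1].
  apply/setP => x; rewrite inE; apply/andP/imsetP.
    case=> /facetP[k kn ->] lt; have kj : k.-1 < j.-1.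
      suff : ~~ (j <= k) by lia.
      by apply: contraL lt => jk; rewrite le_gtF // flag_le //; lia.
    by exists (Ordinal kj) => //=; rewrite prednK //; lia.
  case=> k _ ->; have kj := ltn_ord k; rewrite flag_lt //; last by lia.
  by split=> //; apply/facetP; exists k.+1 => //; lia.
rewrite card_imset ?card_ord // => k k' /(flag_inj flF) E; apply: val_inj.
by have [kj kj'] := (ltn_ord k, ltn_ord k'); rewrite /=; lia.
Qed.

Lemma between_notin_face q : (F j.-1 < q < F j.+1)%O -> q \notin facet F :\ F j.
Proof.
case/andP=> /(graded_homo gr) + /(graded_homo gr); rewrite !flag_rank //; try lia.
move=> lq ql; rewrite !inE negb_and negbK orbC -implyNb negbK; apply/implyP.
case/facetP=> k kn Eq; move: lq ql; rewrite Eq flag_rank //; last by lia.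
by move=> lk kl; rewrite (_ : k = j) //; lia.
Qed.

Lemma coface_between x (t := facet F :\ F j) : x \notin t ->
  x |: t \in order_complex (proper_part B) -> (x \in B) && (F j.-1 < x < F j.+1)%O.
Proof.
move=> xt chain_xt; have xP := chain_proper chain_xt (setU11 x t).
have rx := proper_part_rank xP.
have Ft k : 0 < k < n -> k != j -> F k \in t.
  move=> kn kj; rewrite !inE; apply/andP; split; last by apply/facetP; exists k.
  by apply: contra kj => /eqP/(flag_inj flF)->; lia.
have rxj : rk x = j.
  apply/eqP; apply: contraNT xt => rxj; have Fx := Ft _ rx rxj.
  suff -> : x = F (rk x) by [].
  apply: (chain_rank_inj chain_xt); rewrite ?setU11 ?(setU1r _ Fx) //.
  by rewrite flag_rank //; lia.
have comparable_F k : k <= n -> k != j -> (x >=< F k)%O.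
  move=> kn kj; apply: (chain_comparable chain_xt); first by rewrite !inE eqxx !orbT.
  have [_ _ <- <-] := flF.
  have [->|k0] := eqVneq k 0; first by rewrite setU11.
  have [->|kn'] := eqVneq k n; first by rewrite setU1r // setU11.
  by rewrite !setU1r // Ft //; lia.
move: xP; rewrite proper_partE => /andP[-> _] /=.
have [j1n j1j jn1 jj1] : [/\ j.-1 <= n, j.-1 != j, j.+1 <= n & j.+1 != j].
  by split; lia.
apply/andP; split; apply: graded_lt_comparable; rewrite ?rxj ?flag_rank //; try lia.
  by rewrite comparable_sym comparable_F.
exact: comparable_F.
Qed.

End FlagRelation.

Lemma boundaryE (z : {ffun {set T} -> int}) (t : {set T}) :
  boundary z t = (\sum_(x | x \notin t)
     (-1) ^+ #|[set y in x |: t | (y < x)%O]| * z (x |: t))%R.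
Proof.
rewrite ffunE (exchange_big_dep predT) //= [LHS](bigID [pred x | x \notin t]) /=.
rewrite [X in (_ + X)%R]big1 ?addr0 => [|x /negPn xt]; last first.
  by apply: big1 => s /andP[xs /eqP E]; move: xt; rewrite -E !inE eqxx.
apply: eq_bigr => x xt; rewrite (big_pred1 (x |: t)) // => s /=.
apply/andP/eqP => [[xs /eqP <-]|->]; first by rewrite setD1K.
by rewrite setU11 setU1K.
Qed.

Section FlagCycle.
Local Open Scope ring_scope.
Variable z : {ffun {set T} -> int}.
Hypothesis z_chain : is_chain (proper_part B) n.-1 z.
Hypothesis z_cycle : boundary z = 0.

Lemma support_flag A : (0 < n)%N -> z A != 0 -> exists2 F, flag F & A = facet F.
Proof.
move=> n_gt0 /(implyP (forallP z_chain A))/andP[chainA /eqP].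
exact: maximal_chain_flag.
Qed.

Lemma cycle_flag_sum F j : flag F -> (0 < j < n)%N ->
  \sum_(q in B | (F j.-1 < q < F j.+1)%O) z (facet (update F j q)) = 0.
Proof.
move=> flF jn; pose t := facet F :\ F j.
have /ffunP/(_ t) := z_cycle; rewrite boundaryE ffunE.
rewrite (bigID (fun q => (q \in B) && (F j.-1 < q < F j.+1)%O)) /=.
rewrite [X in _ + X]big1 ?addr0 => [bd|x /andP[xt not_between]]; last first.
  apply/eqP; rewrite mulf_eq0 signr_eq0 /=; apply: contraR not_between => nz.
  have /andP[chain_xt _] := implyP (forallP z_chain _) nz.
  exact: coface_between.
apply: (@mulfI _ ((-1) ^+ j.-1)); rewrite ?signr_eq0 // mulr0 mulr_sumr -[RHS]bd.
apply: eq_big => q.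
  by rewrite [RHS]andb_idl // => /andP[_ /(between_notin_face flF jn)].
case/andP=> qB lq; rewrite -facet_update // -{3}(update_same F j q).
by rewrite card_facet_below //; apply: flag_update.
Qed.

Lemma cycle_flag_exchange F j : flag F -> (0 < j < n)%N -> z (facet F) =
  - \sum_(q in B | (F j.-1 < q < F j.+1)%O && (q != F j)) z (facet (update F j q)).
Proof.
move=> flF jn; have [FjB Fj] := flag_between flF jn.
have := cycle_flag_sum flF jn; rewrite (bigD1 (F j)) ?FjB //= update_id => /eqP.
rewrite addr_eq0 => /eqP->.
by rewrite (eq_bigl _ _ (fun q => andbA _ _ _)).
Qed.

Section Exchange.
Variables (bad : nat -> T -> T -> bool) (P : (nat -> T) -> Prop).
Variables (start : nat) (D : int).

Definition good_below m F : Prop := forall k, (k < m)%N -> ~~ bad k (F k) (F k.+1).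

Hypothesis bad_top : forall F k, flag F -> (k < n)%N -> ~~ bad k (F k) top.
Hypothesis bad_unique : forall F j k q, flag F -> flag (update F j q) ->
  (k < j < n)%N -> good_below k F ->
  bad k (F k) (F j) -> bad k (F k) q -> ~~ bad k (F k) (F j.+1) -> q = F j.
Hypothesis P_update : forall F j q, (start < j)%N -> P F -> P (update F j q).

Lemma good_belowS k F :
  good_below k F -> ~~ bad k (F k) (F k.+1) -> good_below k.+1 F.
Proof. by move=> gF gk i; rewrite ltnS leq_eqVlt => /predU1P[->|/gF]. Qed.

(* A flag that stays bad from step [k] up to index [j] is exchanged at [j]: by
   uniqueness all other flags through the same face turn good earlier. *)
Lemma dvd_good_step k : (start <= k < n)%N ->
  (forall F, flag F -> P F -> good_below k.+1 F -> (D %| z (facet F))%Z) ->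
  forall F, flag F -> P F -> good_below k F -> (D %| z (facet F))%Z.
Proof.
move=> /andP[i0k kn] dvd_good.
suff dvd_upto j : (k <= j < n)%N -> forall F, flag F -> P F -> good_below k F ->
    ~~ bad k (F k) (F j.+1) -> (D %| z (facet F))%Z.
  move=> F flF PF gF; have := dvd_upto n.-1 _ F flF PF gF.
  by rewrite (ltn_predK kn); have [_ _ _ ->] := flF; apply; [lia|exact: bad_top].
elim: j => [|j IH] jn F flF PF gF gj.
  have k0 : k = 0%N by lia.
  by apply: dvd_good => //; apply: good_belowS; rewrite // {3}k0.
have [kj|kj] := eqVneq k j.+1.
  by apply: dvd_good => //; apply: good_belowS; rewrite // {3}kj.
have [bj|gj'] := boolP (bad k (F k) (F j.+1)); last by apply: IH => //; lia.
have j1n : (0 < j.+1 < n)%N by lia.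
rewrite (cycle_flag_exchange flF j1n) rpredN.
apply: rpred_sum => q /and3P[qB lq qF].
have flq : flag (update F j.+1 q) by apply: flag_update.
have update_before i : (i <= k)%N -> update F j.+1 q i = F i.
  by move=> ik; rewrite update_other //; lia.
apply: IH => //; first by lia.
- by apply: P_update => //; lia.
- by move=> i ik; rewrite !update_before ?gF // ltnW.
rewrite update_before // update_same; apply: contra qF => bq; apply/eqP.
by apply: (bad_unique (k := k) flF flq) => //; lia.
Qed.

Lemma dvd_from_good : (start <= n)%N ->
  (forall F, flag F -> P F -> good_below n F -> (D %| z (facet F))%Z) ->
  forall F, flag F -> P F -> good_below start F -> (D %| z (facet F))%Z.
Proof.
move=> i0n dvd_good; suff dvd_below m : (m <= n - start)%N ->
    forall F, flag F -> P F -> good_below (n - m) F -> (D %| z (facet F))%Z.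
  by move=> F flF PF gF; apply: (dvd_below (n - start)%N); rewrite ?subKn.
elim: m => [|m IH] mn; first by rewrite subn0.
apply: dvd_good_step; first by lia.
by rewrite subnSK; [apply: IH; apply: ltnW|lia].
Qed.

End Exchange.

Section Boolean.
Variables (X : finType) (atoms : T -> {set X}).
Hypothesis le_atoms : {in B &, forall p q, (p <= q)%O = (atoms p \subset atoms q)}.
Hypothesis card_atoms : {in B, forall p, #|atoms p| = rk p}.

Lemma boolean_middle_atoms p q r s : p \in B -> q \in B -> r \in B -> s \in B ->
  (p <= q <= s)%O -> (p <= r)%O -> rk r = (rk p).+1 -> rk s = (rk q).+1 ->
  (r <= s)%O -> ~~ (r <= q)%O -> atoms q = atoms s :\: (atoms r :\: atoms p).
Proof.
move=> pB qB rB sB; rewrite !le_atoms // -!card_atoms //.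
move=> /andP[pq qs] pr card_r card_s rs nrq.
have /eqP/cards1P[a ra] : #|atoms r :\: atoms p| = 1%N.
  by rewrite cardsD (setIidPr pr) card_r subSnn.
have atoms_r : atoms r = a |: atoms p.
  by rewrite -ra setUC setDE setUIr setUCr setIT; apply/esym/setUidPr.
have a_notin_q : a \notin atoms q.
  by apply: contra nrq => a_notin_q; rewrite atoms_r subUset sub1set a_notin_q.
have a_in_s : a \in atoms s by apply: (subsetP rs); rewrite atoms_r setU11.
apply/eqP; rewrite ra eqEcard subsetD1 qs a_notin_q /=.
by have := cardsD1 a (atoms s); rewrite a_in_s card_s add1n => -[<-].
Qed.

Lemma boolean_middle_uniq p q q' r s :
  p \in B -> q \in B -> q' \in B -> r \in B -> s \in B ->
  (p <= q <= s)%O -> (p <= q' <= s)%O -> (p <= r <= s)%O -> rk r = (rk p).+1 ->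
  rk s = (rk q).+1 -> rk q' = rk q -> ~~ (r <= q)%O -> ~~ (r <= q')%O -> q = q'.
Proof.
move=> pB qB q'B rB sB pqs pq's /andP[pr rs] rk_r rk_s rk_q' nrq nrq'.
have Eq : atoms q = atoms q'.
  rewrite (boolean_middle_atoms pB qB rB sB pqs) //.
  by rewrite (boolean_middle_atoms pB q'B rB sB pq's) // rk_q'.
by apply/le_anti; rewrite !le_atoms // Eq subxx.
Qed.

Lemma boolean_cycle_dvd (D : int) G : flag G -> (D %| z (facet G))%Z ->
  forall F, flag F -> (D %| z (facet F))%Z.
Proof.
move=> flG dvdG F flF; have [GB _ G0 _] := flG; have [_ le_top _] := graded_top gr.
(* A flag without bad steps follows [G]. *)
pose bad k (_ q : T) := ~~ (G k.+1 <= q)%O.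
have good_prefix m H k :
    flag H -> (m <= n)%N -> good_below bad m H -> (k <= m)%N -> H k = G k.
  move=> flH mn gH; case: k => [_|k km]; first by rewrite G0; case: flH.
  have kn := leq_trans km mn; have := gH k km; rewrite negbK le_eqVlt.
  by case/predU1P=> // /(graded_homo gr); rewrite !flag_rank // ltnn.
apply: (dvd_from_good (bad := bad) (P := fun _ => True) (start := 0%N)) => //.
- by move=> H k flH kn; rewrite negbK le_top // GB.
- move=> H j k q flH flq kj gH; rewrite /bad !negbK => nHj nq le_s.
  have [HB _ _ _] := flH; have [qB _ _ _] := flq.
  have kn : (k <= n)%N by lia.
  have Hk := good_prefix k H k flH kn gH (leqnn k).
  have qE : q = update H j q j by rewrite update_same.
  have pE : G k = update H j q k by rewrite update_other -?Hk //; lia.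
  have sE : H j.+1 = update H j q j.+1 by rewrite update_other //; lia.
  apply: (boolean_middle_uniq (p := G k) (r := G k.+1) (s := H j.+1)) => //.
  all: rewrite ?flag_rank //; try by [apply: GB; lia|apply: HB; lia|lia].
  + by rewrite qE; apply: qB; lia.
  + by rewrite qE pE sE !flag_le //; lia.
  + by rewrite -Hk !flag_le //; lia.
  + by rewrite flag_le //; lia.
  + by rewrite qE flag_rank //; lia.
  + by rewrite qE flag_rank //; lia.
by move=> H flH _ gH; rewrite (eq_facet (G := G)) // => k kn; apply: good_prefix gH _.
Qed.

End Boolean.

End FlagCycle.

End Flags.

Section TopDimension.
Context {d : Order.disp_t} {T : finPOrderType d}.
Variables (B : {set T}) (n : nat) (rk : T -> nat) (bot top : T).
Hypotheses (gr : graded B n rk bot top) (n_ge2 : 2 <= n).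

Let top_dimension : (n - 2).+1 = n.-1.
Proof. lia. Qed.

Lemma top_dimension_card s :
  s \in order_complex (proper_part B) -> #|s| <= (n - 2).+1.
Proof. by rewrite top_dimension; apply: (card_chain gr). Qed.

Lemma top_cycle_is_chain (z : cycles (proper_part B) (n - 2)) :
  is_chain (proper_part B) n.-1 z.
Proof. by rewrite -top_dimension cycle_is_chain. Qed.

Lemma boolean_fundamental_coef (X : finType) (atoms : T -> {set X})
    (z : cycles (proper_part B) (n - 2)) G :
  {in B &, forall p q, (p <= q)%O = (atoms p \subset atoms q)} ->
  {in B, forall p, #|atoms p| = rk p} ->
  fundamental_cycle z -> flag B n bot top G -> `|z (facet n G)| = 1.
Proof.
move=> le_atoms card_atoms fund flG.
apply: fundamental_cycle_primitive fund _ => s.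
have [->|nz] := eqVneq (z s) 0%R; first exact: dvdz0.
have [F flF ->] := support_flag gr (top_cycle_is_chain z) (ltnW n_ge2) nz.
have chain_z := top_cycle_is_chain z; have cycle_z := cycle_boundary z.
exact: (boolean_cycle_dvd gr chain_z cycle_z le_atoms card_atoms flG).
Qed.

End TopDimension.

(** * Signed partitions as signed equivalence relations *)

Section SignedPartitionTheory.
Variable n : nat.
Implicit Types (p q : signed_partition n) (i j k u : 'I_n.+1) (s t : bool).

Definition same_block p i j : bool :=
  [exists b in blocks p, [exists s, (i, s) \in b] && [exists s, (j, s) \in b]].

Definition barred p i : bool := (i, true) \in cover (blocks p).

(* [s] records whether exactly one of the letters [i] and [j] is barred, which
   is not prescribed in the zero block. *)
Definition related p s i j : bool :=
  same_block p i j && (same_block p ord0 i || (barred p i (+) barred p j == s)).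

Lemma barred_block p (b : {set letter n}) i s :
  b \in blocks p -> (i, s) \in b -> barred p i = s.
Proof.
move=> bp ib; rewrite /barred; case: s ib => ib; first by apply/bigcupP; exists b.
by apply/bigcupP => -[c cp ic]; have [] := sp_uniq bp cp ib ic.
Qed.

Lemma block_of p i : exists2 b, b \in blocks p & (i, barred p i) \in b.
Proof.
have : ((i, false) \in cover (blocks p)) (+) ((i, true) \in cover (blocks p)).
  by case: p => P /= /and4P[_ _ /forallP].
rewrite -/(barred p i); case E: (barred p i); last first.
  by rewrite addbF => /bigcupP[b]; exists b.
by move: E => /bigcupP[b]; exists b.
Qed.

Lemma same_blockP p i j : reflect
  (exists2 b, b \in blocks p & (i, barred p i) \in b /\ (j, barred p j) \in b)
  (same_block p i j).
Proof.
apply: (iffP exists_inP) => -[b bp].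
  case/andP=> /existsP[s ib] /existsP[t jb]; exists b => //.
  by rewrite (barred_block bp ib) (barred_block bp jb).
case=> ib jb; exists b => //; apply/andP; split; apply/existsP.
  by exists (barred p i).
by exists (barred p j).
Qed.

Lemma mem_block p (b : {set letter n}) i s : b \in blocks p -> (i, s) \in b ->
  forall j t, ((j, t) \in b) = same_block p i j && (barred p j == t).
Proof.
move=> bp ib j t; apply/idP/andP => [jb|[/same_blockP[c cp [ic jc]] /eqP <-]].
  rewrite (barred_block bp jb); split=> //; apply/same_blockP; exists b => //.
  by rewrite (barred_block bp ib) (barred_block bp jb).
by have [-> _] := sp_uniq bp cp ib ic.
Qed.

Lemma same_refl p i : same_block p i i.
Proof. by apply/same_blockP; have [b bp ib] := block_of p i; exists b. Qed.

Lemma same_sym p i j : same_block p i j = same_block p j i.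
Proof. by apply/same_blockP/same_blockP => -[b bp [ib jb]]; exists b. Qed.

Lemma same_trans p j i k : same_block p i j -> same_block p j k -> same_block p i k.
Proof.
move=> /same_blockP[b bp [ib jb]] /same_blockP[c cp [jc kc]]; apply/same_blockP.
by have [E _] := sp_uniq bp cp jb jc; subst c; exists b.
Qed.

Lemma same_eql p i j k : same_block p i j -> same_block p i k = same_block p j k.
Proof. by move=> ij; apply/idP/idP; apply: same_trans => //; rewrite same_sym. Qed.

Lemma same_eqr p i j k : same_block p i j -> same_block p k i = same_block p k j.
Proof. by rewrite !(same_sym p k); apply: same_eql. Qed.

Lemma barred_zero p i : same_block p ord0 i -> barred p i = false.
Proof.
case/same_blockP=> b bp [/(sp_zero bp) zb]; case: (barred p i) => //.
by case/(sp_bars bp); rewrite zb.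
Qed.

Lemma related_same p s i j : related p s i j -> same_block p i j.
Proof. by case/andP. Qed.

Lemma same_related p i j :
  same_block p i j -> related p (barred p i (+) barred p j) i j.
Proof. by rewrite /related eqxx orbT => ->. Qed.

Lemma related_zero p s i j :
  same_block p ord0 i -> same_block p ord0 j -> related p s i j.
Proof. by move=> zi zj; rewrite /related zi -(same_eql _ zi) zj. Qed.

Lemma related_refl p i : related p false i i.
Proof. by rewrite /related same_refl addbb orbT. Qed.

Lemma related_sym p s i j : related p s i j = related p s j i.
Proof.
rewrite /related same_sym; case ji: (same_block p j i) => //=.
by rewrite (same_eqr _ ji) addbC.
Qed.

Lemma related_trans p s t i j k :
  related p s i j -> related p t j k -> related p (s (+) t) i k.
Proof.
rewrite /related => /andP[ij sij] /andP[jk sjk]; rewrite (same_trans ij jk) /=.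
move: sjk sij; rewrite (same_eqr _ ij).
case: (same_block p ord0 _) => //= /eqP <- /eqP <-.
by rewrite -addbA (addbA (barred p j)) addbb.
Qed.

Lemma related_uniq p s t i j :
  ~~ same_block p ord0 i -> related p s i j -> related p t i j -> s = t.
Proof. by rewrite /related => /negbTE-> /andP[_ /eqP <-] /andP[_ /eqP]. Qed.

Lemma le_same_related p q i j : (p <= q)%O -> same_block p i j ->
  related q (barred p i (+) barred p j) i j.
Proof.
move=> pq /same_blockP[b bp [ib jb]]; have [c cq [bc]] := sp_leP pq bp.
have [[si ic] [sj jc]] := (bc _ _ ib, bc _ _ jb).
case: ifP => [zc _|_ /orP[]/subsetP sub].
- have zero := mem_block cq zc.
  by move: ic jc; rewrite !zero => /andP[zi _] /andP[zj _]; apply: related_zero.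
- move/sub: ib; rewrite (mem_block cq ic) => /andP[_ /eqP <-].
  move/sub: jb; rewrite (mem_block cq ic) => /andP[ij /eqP <-].
  exact: same_related.
have /sub : (i, ~~ barred p i) \in bar b by rewrite in_bar negbK.
have /sub : (j, ~~ barred p j) \in bar b by rewrite in_bar negbK.
rewrite !(mem_block cq ic) => /andP[ij bj] /andP[_ bi].
by have := same_related ij; rewrite (eqP bi) (eqP bj) addbN addNb negbK.
Qed.

Lemma le_related p q s i j : (p <= q)%O -> related p s i j -> related q s i j.
Proof.
move=> pq /andP[ij /orP[zi|/eqP <-]]; last exact: le_same_related.
have zero k : same_block p ord0 k -> same_block q ord0 k.
  by move/(le_same_related pq)/related_same.
by apply: related_zero; apply: zero => //; rewrite -(same_eqr _ ij).
Qed.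

Lemma related_le p q :
  (forall s i j, related p s i j -> related q s i j) -> (p <= q)%O.
Proof.
move=> rel_pq; apply/forall_inP => b bp; have [i ib _] := sp_min bp.
have [c cq ic] := block_of q i; apply/exists_inP; exists c => //.
have rel j s : (j, s) \in b -> related q (s (+) barred p i) i j.
  rewrite (mem_block bp ib) addbC => /andP[ij /eqP <-].
  exact/rel_pq/same_related.
case: ifP => zc.
  have zero := mem_block cq zc; move: ic; rewrite zero => /andP[zi _].
  apply/subsetP => _ /imsetP[[j s] /rel/related_same ij ->].
  by have zj := same_trans zi ij; rewrite zero zj barred_zero.
have nzi : same_block q ord0 i = false.
  apply: contraFF zc => zi; rewrite (mem_block cq ic) same_sym zi.
  by rewrite barred_zero ?same_refl.
have barred_q j s : (j, s) \in b ->
    same_block q i j /\ barred q j = barred q i (+) (s (+) barred p i).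
  move=> /rel/andP[ij]; rewrite nzi => /eqP <-; split=> //.
  by rewrite addbA addbb addFb.
have [E|NE] := eqVneq (barred q i) (barred p i); apply/orP; [left|right].
  apply/subsetP => -[j s] /barred_q[ij]; rewrite E (mem_block cq ic) ij => ->.
  by case: s (barred p i) => [] [].
apply/subsetP => -[j s]; rewrite in_bar => /barred_q[ij].
rewrite (mem_block cq ic) ij => ->.
by case: s (barred q i) (barred p i) NE => [] [] [].
Qed.

Lemma le_same p q i j : (p <= q)%O -> same_block p i j -> same_block q i j.
Proof. by move=> pq /same_related/(le_related pq)/related_same. Qed.

Lemma related_from_above p q s i j : (p <= q)%O -> same_block p i j ->
  (same_block q ord0 i -> same_block p ord0 i) -> related q s i j -> related p s i j.
Proof.
move=> pq ij zero_qp rel_q; have rel_p := same_related ij.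
have [/zero_qp zi|nzi] := boolP (same_block q ord0 i).
  by apply: related_zero; rewrite // -(same_eqr _ ij).
by rewrite (related_uniq nzi rel_q (le_related pq rel_p)).
Qed.

(** * Block representatives and rank *)

Definition block_rep p i : 'I_n.+1 :=
  if same_block p ord0 i then ord0
  else [arg max_(j > i | same_block p i j) (j : nat)].

Definition block_reps p : {set 'I_n.+1} := [set i | block_rep p i == i].

Lemma same_block_rep p i : same_block p i (block_rep p i).
Proof.
rewrite /block_rep; case: ifP => [|_]; first by rewrite same_sym.
by case: arg_maxnP => //; apply: same_refl.
Qed.

Lemma block_rep_max p i j :
  ~~ same_block p ord0 i -> same_block p i j -> j <= block_rep p i.
Proof.
move=> /negbTE nz ij; rewrite /block_rep nz.
by case: arg_maxnP => [|k _]; [apply: same_refl|apply].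
Qed.

Lemma block_rep_eq p i j : (block_rep p i == block_rep p j) = same_block p i j.
Proof.
apply/eqP/idP => [E|ij].
  by apply: same_trans (same_block_rep p i) _; rewrite E same_sym same_block_rep.
have [zi|nzi] := boolP (same_block p ord0 i).
  by rewrite /block_rep -(same_eqr _ ij) zi.
have nzj : ~~ same_block p ord0 j by rewrite -(same_eqr _ ij).
apply/val_inj/eqP; rewrite eqn_leq !block_rep_max //.
  by rewrite (same_eql _ ij) same_block_rep.
by rewrite -(same_eql _ ij) same_block_rep.
Qed.

Lemma block_rep_id p i : i \in block_reps p -> block_rep p i = i.
Proof. by rewrite inE => /eqP. Qed.

Lemma block_rep_in p i : block_rep p i \in block_reps p.
Proof. by rewrite inE block_rep_eq same_sym same_block_rep. Qed.

Lemma block_reps_inj p i j :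
  i \in block_reps p -> j \in block_reps p -> same_block p i j -> i = j.
Proof. by rewrite -block_rep_eq => /block_rep_id -> /block_rep_id -> /eqP. Qed.

Lemma ord0_block_reps p : ord0 \in block_reps p.
Proof. by rewrite inE /block_rep same_refl. Qed.

Lemma block_reps_zero p i : i \in block_reps p -> same_block p ord0 i = (i == ord0).
Proof.
move=> ir; apply/idP/eqP => [|->]; last exact: same_refl.
by move/(block_reps_inj (ord0_block_reps p) ir).
Qed.

Lemma block_repsP p i : ~~ same_block p ord0 i ->
  reflect (forall j, same_block p i j -> j <= i) (i \in block_reps p).
Proof.
move=> nz; apply: (iffP idP) => [/block_rep_id E j ij|i_max].
  by rewrite -E block_rep_max.
rewrite inE; apply/eqP/val_inj/eqP; rewrite eqn_leq i_max ?same_block_rep //=.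
by rewrite block_rep_max ?same_refl.
Qed.

Lemma le_block_reps p q : (p <= q)%O -> block_reps q \subset block_reps p.
Proof.
move=> pq; apply/subsetP => i iq; have [->|i0] := eqVneq i ord0.
  exact: ord0_block_reps.
have nzq : ~~ same_block q ord0 i by rewrite block_reps_zero.
have nzp : ~~ same_block p ord0 i by apply: contra nzq; apply: le_same.
by apply/(block_repsP nzp) => j /(le_same pq); apply: (block_repsP nzq iq).
Qed.

Lemma block_reps_eq p q : (p <= q)%O -> block_reps p = block_reps q -> p = q.
Proof.
move=> pq E; have same_qp i j : same_block q i j -> same_block p i j.
  move=> ij; rewrite -block_rep_eq.
  apply/eqP/(@block_reps_inj q); rewrite -?E ?block_rep_in //.
  rewrite -(same_eql _ (le_same pq (same_block_rep p i))).
  by rewrite -(same_eqr _ (le_same pq (same_block_rep p j))).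
apply/le_anti; rewrite pq; apply: related_le => s i j rel_q.
have ij := related_same rel_q.
by apply: related_from_above pq _ _ rel_q; apply: same_qp.
Qed.

Definition sp_rank p : nat := n.+1 - #|block_reps p|.

Lemma card_block_reps p : 0 < #|block_reps p| <= n.+1.
Proof.
rewrite card_gt0; apply/andP; split; last by rewrite -[leqRHS]card_ord max_card.
by apply/set0Pn; exists ord0; apply: ord0_block_reps.
Qed.

Lemma sp_rank_homo : {homo sp_rank : p q / (p < q)%O >-> p < q}.
Proof.
move=> p q; rewrite lt_neqAle => /andP[neq pq].
have /proper_card : block_reps q \proper block_reps p.
  rewrite properEneq le_block_reps // andbT.
  by apply: contra neq => /eqP E; apply/eqP/block_reps_eq.
by rewrite /sp_rank; have := card_block_reps p; have := card_block_reps q; lia.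
Qed.

Lemma sp_rank_eq p q : (p <= q)%O -> sp_rank p = sp_rank q -> p = q.
Proof.
by rewrite le_eqVlt => /predU1P[//|/sp_rank_homo lt E]; rewrite E ltnn in lt.
Qed.

Lemma cover_block_reps p q : (p <= q)%O -> sp_rank q = (sp_rank p).+1 ->
  exists r, [/\ r != ord0, r \in block_reps p & block_reps q = block_reps p :\ r].
Proof.
move=> pq rank_q; have sub := le_block_reps pq.
have /eqP/cards1P[r E] : #|block_reps p :\: block_reps q| = 1.
  rewrite cardsD (setIidPr sub); move: rank_q; rewrite /sp_rank.
  by have := card_block_reps p; have := card_block_reps q; lia.
have : r \in block_reps p :\: block_reps q by rewrite E inE.
rewrite inE => /andP[rq rp]; exists r; split=> //.
  by apply: contraNneq rq => ->; apply: ord0_block_reps.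
by rewrite -E setDDr setDv set0U (setIidPr sub).
Qed.

Lemma cover_merges_one_pair p q i j k l :
  (p <= q)%O -> sp_rank q = (sp_rank p).+1 ->
  same_block q i j -> ~~ same_block p i j ->
  same_block q k l -> ~~ same_block p k l ->
  (same_block p i k && same_block p j l) || (same_block p i l && same_block p j k).
Proof.
move=> pq rank_q; have [r [_ rp reps_q]] := cover_block_reps pq rank_q.
have in_reps a : block_rep p a != r -> block_rep p a \in block_reps q.
  by rewrite reps_q !inE block_rep_eq same_sym same_block_rep andbT.
have same_reps a b : same_block q a b -> same_block q (block_rep p a) (block_rep p b).
  rewrite (same_eql _ (le_same pq (same_block_rep p a))).
  by rewrite (same_eqr _ (le_same pq (same_block_rep p b))).
have removed a b : same_block q a b -> ~~ same_block p a b ->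
    (block_rep p a == r) || (block_rep p b == r).
  move=> ab; rewrite -block_rep_eq; apply: contraNT => /norP[ar br].
  by apply/eqP/(block_reps_inj (in_reps _ ar) (in_reps _ br)); apply: same_reps.
have partner a b c :
    same_block q a b -> ~~ same_block p a b -> block_rep p a = r ->
    same_block q a c -> ~~ same_block p a c -> same_block p b c.
  rewrite -!(block_rep_eq p) => ab nab ar ac nac; rewrite ar in nab nac.
  apply/eqP; apply: (@block_reps_inj q); rewrite ?in_reps 1?eq_sym //.
  by apply: same_reps; rewrite -(same_eql _ ab).
have merged_pairs a b c d :
    same_block q a b -> ~~ same_block p a b -> block_rep p a = r ->
    same_block q c d -> ~~ same_block p c d -> block_rep p c = r ->
    same_block p a c && same_block p b d.
  move=> ab nab ar cd ncd cr.
  have ac : same_block p a c by rewrite -block_rep_eq ar cr.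
  rewrite ac /=; apply: (partner a) => //; last by rewrite (same_eql _ ac).
  by rewrite (same_eql _ (le_same pq ac)).
move=> ij nij kl nkl; have ji : same_block q j i by rewrite same_sym.
have nji : ~~ same_block p j i by rewrite same_sym.
have lk : same_block q l k by rewrite same_sym.
have nlk : ~~ same_block p l k by rewrite same_sym.
case/orP: (removed _ _ ij nij) => /eqP; case/orP: (removed _ _ kl nkl) => /eqP rk ri.
- by rewrite (merged_pairs i j k l).
- by rewrite (merged_pairs i j l k) // orbT.
- by have /andP[-> ->] := merged_pairs j i k l ji nji ri kl nkl rk; rewrite orbT.
- by have /andP[-> ->] := merged_pairs j i l k ji nji ri lk nlk rk.
Qed.

(** * Covers that leave a block untouched *)

Definition keeps_block u p q : bool :=
  [forall j, same_block q u j ==> same_block p u j].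

Lemma keeps_blockP u p q :
  reflect (forall j, same_block q u j -> same_block p u j) (keeps_block u p q).
Proof. by apply: (iffP forallP) => keep j; apply/implyP; apply: keep. Qed.

Lemma zero_touches_block u p q :
  ~~ same_block p ord0 u -> same_block q ord0 u -> ~~ keeps_block u p q.
Proof.
move=> nzp zq; apply: contra nzp => /keeps_blockP keep.
by rewrite same_sym keep // same_sym.
Qed.

Lemma merged_outside_block u p q r i j : (p <= q)%O -> (q <= r)%O ->
  sp_rank r = (sp_rank q).+1 -> keeps_block u p q -> ~~ keeps_block u p r ->
  ~~ same_block p u i -> ~~ same_block p u j -> same_block r i j -> same_block q i j.
Proof.
move=> pq qr rank_r /keeps_blockP keep_q; rewrite negb_forall => /existsP[k].
rewrite negb_imply => /andP[uk nuk] ui uj ij; apply: contraT => nij.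
have nuk' : ~~ same_block q u k by apply: contra nuk; apply: keep_q.
have := cover_merges_one_pair qr rank_r ij nij uk nuk'.
rewrite !(same_sym q _ u); case/orP=> /andP[].
  by move=> /keep_q; rewrite (negbTE ui).
by move=> _ /keep_q; rewrite (negbTE uj).
Qed.

Lemma keeps_block_le u p q q' r : ~~ same_block p ord0 u ->
  (p <= q)%O -> (p <= q')%O -> (q <= r)%O -> (q' <= r)%O ->
  sp_rank r = (sp_rank q').+1 ->
  keeps_block u p q -> keeps_block u p q' -> ~~ keeps_block u p r -> (q <= q')%O.
Proof.
move=> nzu pq pq' qr q'r rank_r keep_q keep_q' touch_r.
have outside i j : ~~ same_block p u i -> ~~ same_block p u j ->
  same_block r i j -> same_block q' i j by apply: merged_outside_block.
move/keeps_blockP in keep_q; move/keeps_blockP in keep_q'.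
have nz0 : ~~ same_block p u ord0 by rewrite same_sym.
apply: related_le => s i j rel_q; have ij := related_same rel_q.
have [ui|ui] := boolP (same_block p u i).
  have pij : same_block p i j.
    rewrite -(same_eql _ ui); apply: keep_q.
    by rewrite (same_eql _ (le_same pq ui)).
  apply: (le_related pq'); apply: (related_from_above pq pij _ rel_q) => zi.
  have /keep_q : same_block q u ord0.
    by rewrite same_sym (same_eqr _ (le_same pq ui)).
  by rewrite (negbTE nz0).
have uj : ~~ same_block p u j.
  apply: contra ui => uj; apply: keep_q.
  by rewrite (same_eqr _ ij); apply: le_same uj.
apply: related_from_above q'r _ _ (le_related qr rel_q); last exact: outside.
by apply: outside => //; apply: le_same ij.
Qed.

Lemma keeps_block_uniq u p q q' r : ~~ same_block p ord0 u ->
  (p <= q)%O -> (p <= q')%O -> (q <= r)%O -> (q' <= r)%O ->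
  sp_rank r = (sp_rank q).+1 -> sp_rank r = (sp_rank q').+1 ->
  keeps_block u p q -> keeps_block u p q' -> ~~ keeps_block u p r -> q = q'.
Proof.
move=> nzu pq pq' qr q'r rank_q rank_q' keep_q keep_q' touch_r.
apply/le_anti; rewrite (keeps_block_le nzu pq pq' qr q'r) //.
exact: (keeps_block_le nzu pq' pq q'r qr).
Qed.

Definition max_nonzero p : 'I_n.+1 :=
  inord (\max_(i | ~~ same_block p ord0 i) (i : nat)).

Lemma nonzero_exists p : sp_rank p < n -> exists i, ~~ same_block p ord0 i.
Proof.
move=> rank_p; apply/existsP; rewrite -negb_forall.
apply: contraL rank_p => /forallP zero.
suff -> : sp_rank p = n by rewrite ltnn.
rewrite /sp_rank (_ : block_reps p = [set ord0]) ?cards1 ?subn1 //.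
by apply/setP => i; rewrite !inE /block_rep zero eq_sym.
Qed.

Lemma max_nonzeroP p : sp_rank p < n ->
  ~~ same_block p ord0 (max_nonzero p) /\
  (forall j, ~~ same_block p ord0 j -> j <= max_nonzero p).
Proof.
case/nonzero_exists=> i nzi.
have : 0 < #|[pred i | ~~ same_block p ord0 i]| by apply/card_gt0P; exists i.
case/(eq_bigmax_cond (fun i : 'I_n.+1 => i : nat)) => u nzu max_u.
have -> : max_nonzero p = u by rewrite /max_nonzero max_u inord_val.
by split=> // j nzj; rewrite -max_u; apply: (bigop.bigmax_sup j).
Qed.

Lemma max_nonzero_rep p : sp_rank p < n -> max_nonzero p \in block_reps p.
Proof.
move=> /max_nonzeroP[nz u_max]; apply/(block_repsP nz) => j uj; apply: u_max.
by rewrite -(same_eqr _ uj).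
Qed.

End SignedPartitionTheory.

(** * Splittings *)

Local Notation letter_at w i := (lift ord0 (w i)).

Section Splittings.
Variable n : nat.
Implicit Types (p q : signed_partition n) (w : 'S_n) (e : {ffun 'I_n -> bool}).
Implicit Types (S : {set 'I_n}) (i j c : 'I_n).

Variant letter_spec w : 'I_n.+1 -> Prop :=
  | ZeroLetter : letter_spec w ord0
  | LetterAt i : letter_spec w (letter_at w i).

Lemma letter_atP w (a : 'I_n.+1) : letter_spec w a.
Proof.
case: (unliftP ord0 a) => [v ->|->]; last exact: ZeroLetter.
by rewrite -(permKV w v); apply: LetterAt.
Qed.

Lemma letter_at_inj w : injective (fun i => letter_at w i).
Proof. by move=> i j /lift_inj /perm_inj. Qed.

Lemma mem_split_zero_block w S i s :
  ((letter_at w i, s) \in split_zero_block w S) = ~~ s && [forall c in S, i < c].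
Proof.
apply/idP/andP => [/in_zero_block[/(congr1 fst) //|[j jS E]]|[/negbTE -> iS]].
  have /lift_inj/perm_inj-> := congr1 fst E; have /= -> := congr1 snd E.
  by split=> //; apply/forall_inP.
by rewrite !inE; apply/orP; right; apply/imsetP; exists i; rewrite ?inE.
Qed.

Lemma mem_split_block w e S c i s : ((letter_at w i, s) \in split_block w e S c) =
  [&& s == e i, c <= i & [forall j in S, (c < j) ==> (i < j)]].
Proof.
apply/imsetP/andP => [[j + E]|[/eqP-> h]].
  have /lift_inj/perm_inj-> := congr1 fst E; have /= -> := congr1 snd E.
  by rewrite inE eqxx => ->.
by exists i; rewrite ?inE.
Qed.

Lemma mem_normalize_split_block w e S c i s :
  ((letter_at w i, s) \in normalize (split_block w e S c)) =
  [&& s == e i (+) ~~ min_unbarred (split_block w e S c),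
      c <= i & [forall j in S, (c < j) ==> (i < j)]].
Proof.
rewrite /normalize; case: ifP => _; rewrite ?in_bar mem_split_block ?addbF ?addbT //.
by congr (_ && _); case: s; case: (e i).
Qed.

Variant splitting_block_spec w e S : {set letter n} -> Prop :=
  | SplittingZeroBlock : splitting_block_spec w e S (split_zero_block w S)
  | SplittingNonzeroBlock c of c \in S :
      splitting_block_spec w e S (normalize (split_block w e S c)).

Lemma splitting_blockP w e S b :
  b \in blocks (splitting w e S) -> splitting_block_spec w e S b.
Proof.
rewrite /= !inE => /orP[/eqP->|/imsetP[c cS ->]]; first exact: SplittingZeroBlock.
exact: SplittingNonzeroBlock.
Qed.

Lemma same_splitting w e S i j :
  same_block (splitting w e S) (letter_at w i) (letter_at w j) =
  [forall c in S, (c <= i) == (c <= j)].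
Proof.
set p := splitting w e S; have [b bp ib] := block_of p (letter_at w i).
transitivity [exists s, (letter_at w j, s) \in b].
  apply/idP/existsP => [ij|[s]]; last by rewrite (mem_block bp ib) => /andP[].
  by exists (barred p (letter_at w j)); rewrite (mem_block bp ib) ij eqxx.
case/splitting_blockP: bp ib => [|c cS].
  rewrite mem_split_zero_block => /andP[_ /forall_inP iS].
  apply/existsP/forall_inP => [[s] + c cS|same_cuts].
    rewrite mem_split_zero_block => /andP[_ /forall_inP/(_ c cS)].
    by have := iS c cS; lia.
  exists false; rewrite mem_split_zero_block; apply/forall_inP => c cS.
  by have := iS c cS; have /eqP := same_cuts c cS; lia.
rewrite mem_normalize_split_block => /and3P[_ ci /forall_inP iS].
apply/existsP/forall_inP => [[s] + k kS|same_cuts].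
  rewrite mem_normalize_split_block => /and3P[_ cj /forall_inP/(_ k kS)].
  by have := iS k kS; lia.
exists (e j (+) ~~ min_unbarred (split_block w e S c)).
rewrite mem_normalize_split_block eqxx -(eqP (same_cuts c cS)) ci /=.
by apply/forall_inP => k kS; have := iS k kS; have /eqP := same_cuts k kS; lia.
Qed.

Lemma zero_splitting w e S i :
  same_block (splitting w e S) ord0 (letter_at w i) = [forall c in S, i < c].
Proof.
set p := splitting w e S.
have zb : split_zero_block w S \in blocks p by rewrite /= setU11.
have zero_in : (ord0, false) \in split_zero_block w S by rewrite setU11.
have := mem_block zb zero_in (letter_at w i) false.
rewrite mem_split_zero_block /= => ->.
by rewrite andb_idr // => zi; rewrite barred_zero.
Qed.

Definition linked p w e i j : bool :=
  related p (e i (+) e j) (letter_at w i) (letter_at w j).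

Lemma linked_same p w e i j :
  linked p w e i j -> same_block p (letter_at w i) (letter_at w j).
Proof. exact: related_same. Qed.

Lemma linked_refl p w e i : linked p w e i i.
Proof. by rewrite /linked addbb related_refl. Qed.

Lemma linked_sym p w e i j : linked p w e i j = linked p w e j i.
Proof. by rewrite /linked related_sym addbC. Qed.

Lemma linked_trans p w e j i k :
  linked p w e i j -> linked p w e j k -> linked p w e i k.
Proof.
by move=> ij jk; have := related_trans ij jk; rewrite -addbA (addbA (e j)) addbb.
Qed.

Lemma linked_le p q w e i j : (p <= q)%O -> linked p w e i j -> linked q w e i j.
Proof. exact: le_related. Qed.

Lemma linked_splitting w e S i j :
  linked (splitting w e S) w e i j = [forall c in S, (c <= i) == (c <= j)].
Proof.
rewrite -(same_splitting w e) /linked /related.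
rewrite andb_idr // => /same_blockP[b bp [ib jb]].
apply/orP; case/splitting_blockP: bp ib jb => [|c cS].
  by rewrite mem_split_zero_block -(zero_splitting w e) => /andP[_ ->]; left.
rewrite !mem_normalize_split_block => /and3P[/eqP-> _ _] /and3P[/eqP-> _ _].
by right; rewrite addbACA addbb addbF.
Qed.

Lemma linked_between w e S q :
  (forall i j, j = i.+1 :> nat -> j \notin S -> linked q w e i j) ->
  forall i j, i <= j -> (forall c, c \in S -> i < c -> j < c) -> linked q w e i j.
Proof.
move=> adj i; suff linked_at m : forall j, j = i + m :> nat ->
    (forall c, c \in S -> i < c -> j < c) -> linked q w e i j.
  by move=> j ij; apply: (linked_at (j - i)); lia.
elim: m => [|m IH] j jE cuts.
  have -> : i = j by apply: val_inj; rewrite /= jE addn0.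
  exact: linked_refl.
have lt_j : i + m < n by have := ltn_ord j; lia.
apply: (@linked_trans _ _ _ (Ordinal lt_j)).
  by apply: IH => // c cS ic /=; have := cuts c cS ic; lia.
apply: adj => /=; first by lia.
by apply/negP => /cuts; lia.
Qed.

Lemma splitting_le w e S q :
  (forall i j, j = i.+1 :> nat -> j \notin S -> linked q w e i j) ->
  (forall i, i = 0 :> nat -> i \notin S -> same_block q ord0 (letter_at w i)) ->
  (splitting w e S <= q)%O.
Proof.
move=> adj adj0; set p := splitting w e S; have between := linked_between adj.
have zero a : same_block p ord0 a -> same_block q ord0 a.
  case: (letter_atP w a) => [|i]; first by rewrite !same_refl.
  rewrite zero_splitting => /forall_inP iS.
  have n0 : 0 < n by apply: leq_ltn_trans (ltn_ord i).
  apply: (@same_trans _ _ (letter_at w (Ordinal n0))).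
    by apply: adj0 => //; apply/negP => /iS.
  by apply/(@linked_same _ _ e)/between => // c /iS.
have link i j : same_block p (letter_at w i) (letter_at w j) -> linked q w e i j.
  rewrite same_splitting => /forall_inP same_cuts; case: (leqP i j) => ij.
    by apply: between => // c /same_cuts; lia.
  by rewrite linked_sym; apply: between => [|c /same_cuts]; lia.
apply: related_le => s a b rel_p; have ab := related_same rel_p.
have [za|nza] := boolP (same_block p ord0 a).
  by apply: related_zero; apply: zero; rewrite // -(same_eqr _ ab).
move: ab nza rel_p; case: (letter_atP w a) => [|i]; first by rewrite same_refl.
case: (letter_atP w b) => [|j]; first by rewrite same_sym => ->.
move=> ij nzi rel_p.
have link_p : linked p w e i j by rewrite linked_splitting -(same_splitting w e).
by rewrite (related_uniq nzi rel_p link_p); apply: link.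
Qed.

Lemma splittingS w e S S' : S' \subset S -> (splitting w e S <= splitting w e S')%O.
Proof.
move=> /subsetP sub; apply: splitting_le => [i j ij jS|i i0 iS].
  rewrite linked_splitting; apply/forall_inP => c /sub cS.
  by have : c != j :> nat by [apply: contraNneq jS => /val_inj <-]; lia.
rewrite zero_splitting; apply/forall_inP => c /sub cS.
rewrite i0 lt0n; apply: contraNneq iS => c0.
by rewrite (_ : i = c) //; apply: val_inj; rewrite /= i0.
Qed.

Lemma splitting_last_cut w e S i (p := splitting w e S) :
  ~~ same_block p ord0 (letter_at w i) ->
  exists2 c, c \in S & same_block p (letter_at w i) (letter_at w c).
Proof.
rewrite zero_splitting negb_forall => /existsP[c0].
rewrite negb_imply -leqNgt => c0P.
have {}c0P : [pred c : 'I_n | (c \in S) && (c <= i)] c0 := c0P.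
case: (arg_maxnP (fun c : 'I_n => c : nat) c0P) => c /andP[cS ci] c_max.
exists c => //; rewrite same_splitting; apply/forall_inP => k kS.
case: (leqP k i) => ki; first by have /= -> : geq c k by apply: c_max; rewrite /= kS.
by rewrite leqNgt (leq_ltn_trans ci ki).
Qed.

Lemma card_block_reps_splitting w e S : #|block_reps (splitting w e S)| = #|S|.+1.
Proof.
set p := splitting w e S; pose rep c := block_rep p (letter_at w c).
have rep_inj : {in S &, injective rep}.
  move=> c c' cS c'S /eqP; rewrite block_rep_eq same_splitting => /forall_inP same_cuts.
  apply: val_inj; have := same_cuts c cS; have := same_cuts c' c'S.
  by rewrite /= !leqnn; lia.
rewrite (cardsD1 ord0) ord0_block_reps add1n -(card_in_imset rep_inj).
congr (#|pred_of_set _|.+1); apply/setP => r; rewrite in_setD1; apply/andP/imsetP.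
  case: (letter_atP w r) => [[]|i [_ ir]]; first by rewrite eqxx.
  have [|c cS ic] := @splitting_last_cut w e S i; first by rewrite block_reps_zero.
  by exists c => //; rewrite -[LHS](block_rep_id ir); apply/eqP; rewrite block_rep_eq.
case=> c cS ->; rewrite block_rep_in -(block_reps_zero (block_rep_in _ _)).
split=> //; rewrite -(same_eqr _ (same_block_rep p _)) zero_splitting.
by apply/forall_inP => /(_ c cS); rewrite ltnn.
Qed.

Lemma sp_rank_splitting w e S : sp_rank (splitting w e S) = n - #|S|.
Proof. by rewrite /sp_rank card_block_reps_splitting subSS. Qed.

Definition sp_bot : signed_partition n := splitting 1%g [ffun=> false] setT.
Definition sp_top : signed_partition n := splitting 1%g [ffun=> false] set0.

Lemma sp_bot_le p : (sp_bot <= p)%O.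
Proof. by apply: splitting_le => [i j|i] _; rewrite inE. Qed.

Lemma splitting_setT w e : splitting w e setT = sp_bot.
Proof.
apply/le_anti; rewrite sp_bot_le andbT.
by apply: splitting_le => [i j|i] _; rewrite inE.
Qed.

Lemma zero_splitting_set0 w e a : same_block (splitting w e set0) ord0 a.
Proof.
case: (letter_atP w a) => [|i]; first exact: same_refl.
by rewrite zero_splitting; apply/forall_inP => c; rewrite inE.
Qed.

Lemma le_splitting_set0 w e p : (p <= splitting w e set0)%O.
Proof.
by apply: related_le => s a b _; apply: related_zero; apply: zero_splitting_set0.
Qed.

Lemma splitting_set0 w e : splitting w e set0 = sp_top.
Proof. by apply/le_anti; rewrite !le_splitting_set0. Qed.

Lemma in_PiD p : (p \in PiD n) = (#|[set a | same_block p ord0 a]| != 2).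
Proof.
have [b bp zb] := block_of p ord0; rewrite barred_zero ?same_refl // in zb.
have -> : #|[set a | same_block p ord0 a]| = #|b|.
  have inj : injective (fun a : 'I_n.+1 => (a, false)) by move=> a a' [].
  rewrite -(card_imset _ inj).
  apply: eq_card => -[a s]; rewrite (mem_block bp zb); apply/imsetP/andP.
    by case=> a' + [-> ->]; rewrite inE => za; rewrite barred_zero.
  by case=> za; rewrite barred_zero // => /eqP <-; exists a; rewrite ?inE.
rewrite inE; apply/forall_inP/idP => [/(_ b bp)|card_b c cp]; first by rewrite zb.
by apply/implyP => zc; have [<- _] := sp_uniq bp cp zb zc.
Qed.

End Splittings.

Section AdmissibleSplittings.
Variable m : nat.
Local Notation n := m.+2.
Local Notation pos1 := (lift ord0 ord0 : 'I_n).
Implicit Types (w : 'S_n) (e : {ffun 'I_n -> bool}) (S : {set 'I_n}) (i : 'I_n).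

Lemma ord_gt0 i : (0 < i) = (i != ord0).
Proof. by rewrite lt0n. Qed.

Lemma zero_splitting_first w e S :
  same_block (splitting w e S) ord0 (letter_at w ord0) = (ord0 \notin S).
Proof.
rewrite zero_splitting; apply/forall_inP/idP => [S_gt0|zS c cS].
  by apply/negP => /S_gt0.
by rewrite ord_gt0; apply: contraNneq zS => <-.
Qed.

Lemma admissible_zero w e S i : admissible S -> ord0 \notin S -> i <= 1 ->
  same_block (splitting w e S) ord0 (letter_at w i).
Proof.
move=> /forall_inP adm; rewrite -(zero_splitting_first w e) !zero_splitting.
move=> /forall_inP S_gt0 i1; apply/forall_inP => c cS; apply: leq_ltn_trans i1 _.
rewrite ltn_neqAle S_gt0 // andbT eq_sym; apply/eqP => c1; have /implyP := adm c cS.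
by rewrite c1 => /(_ _)/negP; apply=> //; apply/forall_inP => j /S_gt0.
Qed.

Lemma admissible_PiD w e S : admissible S -> splitting w e S \in PiD n.
Proof.
move=> adm; rewrite in_PiD; set p := splitting w e S.
have [z0|nz0] := boolP (ord0 \in S).
  rewrite (_ : [set a | _] = [set ord0]) ?cards1 //; apply/setP => a; rewrite !inE.
  case: (letter_atP w a) => [|i]; first by rewrite same_refl eqxx.
  by rewrite zero_splitting; apply/forall_inP => /(_ _ z0).
have sub3 : [set ord0; letter_at w ord0; letter_at w pos1]
    \subset [set a | same_block p ord0 a].
  apply/subsetP => a; rewrite !inE -orbA => /or3P[]/eqP->; first exact: same_refl.
    exact: admissible_zero.
  exact: admissible_zero.
have := subset_leq_card sub3; rewrite setUC cardsU1 cards2 !inE.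
rewrite (inj_eq (@letter_at_inj n w)) eq_sym (negbTE (neq_lift _ _)) /=.
by case: #|_| => [|[|[|]]].
Qed.

Lemma admissible_set0 : admissible (set0 : {set 'I_n}).
Proof. by apply/forall_inP => i; rewrite inE. Qed.

Lemma admissible_setT : admissible (setT : {set 'I_n}).
Proof.
apply/forall_inP => i _; apply/implyP => /forall_inP i_min.
by have := i_min ord0 (in_setT _); rewrite leqn0 => /eqP->.
Qed.

Lemma graded_PiD : graded (PiD n) n (@sp_rank n) (sp_bot n) (sp_top n).
Proof.
split; first exact: sp_rank_homo.
  split=> [|p _|]; [exact/admissible_PiD/admissible_setT|exact: sp_bot_le|].
  by rewrite sp_rank_splitting cardsT card_ord subnn.
split=> [|p _|]; [exact/admissible_PiD/admissible_set0|exact: le_splitting_set0|].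
by rewrite sp_rank_splitting cards0 subn0.
Qed.

End AdmissibleSplittings.

(** * Segments of a permutation *)

Lemma card_ord_lt_inj n (f : 'I_n -> 'I_n) a :
  injective f -> a <= n -> #|[set i | f i < a]| = a.
Proof.
move=> f_inj an; have -> : [set i | f i < a] = f @^-1: [set i : 'I_n | i < a].
  by apply/setP => i; rewrite !inE.
rewrite card_preimset // -sum1_card (eq_bigl (fun i : 'I_n => i < a)).
  by rewrite -(big_ord_widen _ (fun=> 1) an) sum1_card card_ord.
by move=> i; rewrite inE.
Qed.

Lemma card_ord_geq_inj n (f : 'I_n -> 'I_n) a :
  injective f -> a <= n -> #|[set i | a <= f i]| = n - a.
Proof.
move=> f_inj an; rewrite cardsCs card_ord; congr (_ - _).
rewrite -[RHS](card_ord_lt_inj f_inj an).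
by apply: eq_card => i; rewrite !inE ltnNge.
Qed.

Section Segments.
Variable n : nat.
Implicit Types (w v : 'S_n) (i j c : 'I_n).

Definition seg_end w i : 'I_n := [arg max_(j > i | i <= j) (w j : nat)].

Definition seg_start w i : 'I_n :=
  [arg min_(j < i | seg_end w j == seg_end w i) (j : nat)].

Lemma seg_end_ge w i : i <= seg_end w i.
Proof. by rewrite /seg_end; case: arg_maxnP. Qed.

Lemma seg_end_max w i j : i <= j -> w j <= w (seg_end w i).
Proof. by rewrite /seg_end; case: arg_maxnP => // k _; apply. Qed.

Lemma seg_end_uniq w i c :
  i <= c -> (forall j, i <= j -> w j <= w c) -> seg_end w i = c.
Proof.
move=> ic c_max; apply: (@perm_inj _ w); apply/val_inj/eqP.
by rewrite eqn_leq c_max ?seg_end_ge // seg_end_max.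
Qed.

Lemma seg_end_eq w i j : i <= j <= seg_end w i -> seg_end w j = seg_end w i.
Proof.
move=> /andP[ij je]; apply: seg_end_uniq => // k jk.
by apply: seg_end_max; apply: leq_trans jk.
Qed.

Lemma seg_endK w i : seg_end w (seg_end w i) = seg_end w i.
Proof. by apply: seg_end_eq; rewrite seg_end_ge /=. Qed.

Lemma seg_end_mono w i j : i <= j -> seg_end w i <= seg_end w j.
Proof.
move=> ij; case: (leqP j (seg_end w i)) => [je|ej].
  by rewrite (@seg_end_eq w i j) ?ij.
exact: leq_trans (ltnW ej) (seg_end_ge _ _).
Qed.

Lemma rtl_maxE w i : rtl_max w i = (seg_end w i == i).
Proof.
apply/forallP/eqP => [i_max|E j].
  apply: seg_end_uniq => // j; rewrite leq_eqVlt => /predU1P[/val_inj->//|ij].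
  by apply: ltnW; apply: (implyP (i_max j)).
apply/implyP => ij; rewrite ltn_neqAle; apply/andP; split.
  by apply: contraTneq ij => /val_inj/perm_inj ->; rewrite ltnn.
by rewrite -[in leqRHS]E; apply/seg_end_max/ltnW.
Qed.

Lemma seg_startP w i : seg_end w (seg_start w i) = seg_end w i /\
  (forall j, seg_end w j = seg_end w i -> seg_start w i <= j).
Proof.
rewrite /seg_start; case: arg_minnP => // j /eqP ej j_min.
by split=> // k /eqP /j_min.
Qed.

Lemma seg_end_start w i : seg_end w (seg_start w i) = seg_end w i.
Proof. by case: (seg_startP w i). Qed.

Lemma seg_start_le w i : seg_start w i <= i.
Proof. by case: (seg_startP w i) => _; apply. Qed.

Lemma seg_start_eq w i j :
  seg_end w i = seg_end w j -> seg_start w i = seg_start w j.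
Proof.
move=> E; have [[ei mi] [ej mj]] := (seg_startP w i, seg_startP w j).
by apply/val_inj/eqP; rewrite eqn_leq mi ?mj ?ei ?ej.
Qed.

Lemma in_segment w i j :
  seg_start w i <= j <= seg_end w i -> seg_end w j = seg_end w i.
Proof.
by move=> ij; rewrite -(seg_end_start w i); apply: seg_end_eq; rewrite seg_end_start.
Qed.

Lemma segment_lt w i j : seg_end w i < j -> seg_end w i < seg_start w j.
Proof.
move=> ij; rewrite ltnNge; apply/negP => ji.
have : seg_end w (seg_end w i) = seg_end w j.
  by apply: in_segment; rewrite ji (leq_trans (ltnW ij) (seg_end_ge w j)).
by rewrite seg_endK => E; have := seg_end_ge w j; rewrite -E leqNgt ij.
Qed.

Lemma seg_end_lt w i j : seg_end w i < seg_end w j -> seg_end w i < j.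
Proof.
move=> lt; rewrite ltnNge; apply/negP => /(seg_end_mono w).
by rewrite seg_endK leqNgt lt.
Qed.

Lemma seg_end_lt_start w i j : (seg_end w j < seg_start w i) = (j < seg_start w i).
Proof.
apply/idP/idP => [|ji]; first by apply: leq_ltn_trans (seg_end_ge w j).
apply: seg_end_lt; rewrite ltn_neqAle seg_end_mono ?(ltnW ji) // andbT.
apply: contraTneq ji => /val_inj E; rewrite -leqNgt.
by have [_ start_min] := seg_startP w i; apply: start_min; rewrite E seg_end_start.
Qed.

Lemma eq_seg_start w v : (forall i, seg_end v i = seg_end w i) ->
  forall i, seg_start v i = seg_start w i.
Proof.
move=> E i; have [[ei mi] [ej mj]] := (seg_startP v i, seg_startP w i).
by apply/val_inj/eqP; rewrite eqn_leq mi ?mj -?E ?ei // E ej.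
Qed.

Fact cut_time_proof w i : seg_start w i + seg_end w i - i < n.
Proof. by have := seg_start_le w i; have := ltn_ord (seg_end w i); lia. Qed.

(* The step at which the cut at position [i] is removed: segments are treated
   from left to right, the cuts of a segment from right to left. *)
Definition cut_time w i : 'I_n := Ordinal (cut_time_proof w i).

Lemma seg_end_cut_time w i : seg_end w (cut_time w i) = seg_end w i.
Proof.
apply: in_segment => /=.
by have := seg_start_le w i; have := seg_end_ge w i; lia.
Qed.

Lemma cut_timeK w : involutive (cut_time w).
Proof.
move=> i; apply: val_inj => /=.
rewrite seg_end_cut_time (seg_start_eq (seg_end_cut_time w i)).
by have := seg_start_le w i; have := seg_end_ge w i; lia.
Qed.

Lemma cut_time_start w i : cut_time w (seg_start w i) = seg_end w i.
Proof.
apply: val_inj; rewrite /= seg_end_start (seg_start_eq (seg_end_start w i)).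
by rewrite addKn.
Qed.

Fact letter_time_proof w i :
  (if i == seg_end w i then i : nat else seg_start w i + seg_end w i - i.+1) < n.
Proof.
case: ifP => _; first exact: ltn_ord.
by have := seg_start_le w i; have := ltn_ord (seg_end w i); lia.
Qed.

(* The step at which the letter at position [i] ceases to represent its block. *)
Definition letter_time w i : 'I_n := Ordinal (letter_time_proof w i).

Lemma letter_timeE w i : i != seg_end w i ->
  letter_time w i = seg_start w i + seg_end w i - i.+1 :> nat.
Proof. by move=> /= /negbTE->. Qed.

Lemma letter_time_id w i : letter_time w (seg_end w i) = seg_end w i.
Proof. by apply: val_inj => /=; rewrite seg_endK eqxx. Qed.

Lemma lt_seg_end w i : i != seg_end w i -> i < seg_end w i.
Proof. by move=> ne; rewrite ltn_neqAle ne seg_end_ge. Qed.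

Lemma letter_time_lt w i : i != seg_end w i -> letter_time w i < seg_end w i.
Proof.
move=> ne; rewrite letter_timeE //.
by have := seg_start_le w i; have := lt_seg_end ne; lia.
Qed.

Lemma letter_time_le w i : letter_time w i <= seg_end w i.
Proof.
have [E|/letter_time_lt/ltnW//] := eqVneq i (seg_end w i).
by rewrite {1}E letter_time_id.
Qed.

Lemma letter_time_lt_neq w i k :
  letter_time w i < k <= seg_end w i -> i != seg_end w i.
Proof. by apply: contraTneq => E; rewrite {1}E letter_time_id; lia. Qed.

Lemma seg_end_letter_time w i : seg_end w (letter_time w i) = seg_end w i.
Proof.
have [E|ne] := eqVneq i (seg_end w i); first by rewrite {1}E letter_time_id seg_endK.
apply: in_segment; rewrite letter_timeE //.
by have := seg_start_le w i; have := lt_seg_end ne; lia.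
Qed.

Lemma cut_time_succ w i j : j = i.+1 :> nat -> j <= seg_end w i ->
  cut_time w j = letter_time w i :> nat.
Proof.
move=> ji je; have Ej : seg_end w j = seg_end w i.
  by apply: seg_end_eq; rewrite je ji leqnSn.
have ne : i != seg_end w i by rewrite -val_eqE /= neq_ltn -ji je.
by rewrite letter_timeE //= Ej (seg_start_eq Ej) ji.
Qed.

Lemma letter_timeK w : involutive (letter_time w).
Proof.
move=> i; have [E|ne] := eqVneq i (seg_end w i); first by rewrite E !letter_time_id.
apply: ord_inj; rewrite letter_timeE seg_end_letter_time; last first.
  by rewrite -val_eqE ltn_eqF // letter_time_lt.
rewrite (seg_start_eq (seg_end_letter_time w i)) letter_timeE //.
by have := seg_start_le w i; have := lt_seg_end ne; lia.
Qed.

Lemma seg_start_letter_time w i : seg_start w i <= letter_time w i.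
Proof. by rewrite -(seg_start_eq (seg_end_letter_time w i)) seg_start_le. Qed.

Definition letter_perm w : 'S_n := perm (can_inj (letter_timeK w)).

Lemma seg_end_reindex w v : (forall i, seg_end w (v i) = seg_end w i) ->
  (forall i, v (seg_end w i) = seg_end w i) ->
  forall i, seg_end (v * w)%g i = seg_end w i.
Proof.
move=> v_seg v_end i; apply: seg_end_uniq; first exact: seg_end_ge.
move=> j ij; rewrite !permM v_end.
case: (leqP i (v j)) => [ivj|vji]; first exact: seg_end_max.
suff <- : seg_end w j = seg_end w i by rewrite -(v_seg j); apply: seg_end_max.
apply/val_inj/eqP; rewrite eqn_leq (seg_end_mono w ij) andbT.
by rewrite -(v_seg j) seg_end_mono // ltnW.
Qed.

Lemma seg_end_letter_perm w i : seg_end (letter_perm w * w)%g i = seg_end w i.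
Proof.
apply: seg_end_reindex => {}i; rewrite permE; last exact: letter_time_id.
exact: seg_end_letter_time.
Qed.

Lemma letter_time_letter_perm w i :
  letter_time (letter_perm w * w)%g i = letter_time w i.
Proof.
apply: val_inj => /=.
by rewrite (eq_seg_start (seg_end_letter_perm w)) seg_end_letter_perm.
Qed.

Definition cuts w (k : nat) : {set 'I_n} := [set i | k <= cut_time w i].

Lemma card_cuts w k : k <= n -> #|cuts w k| = n - k.
Proof. exact: card_ord_geq_inj (can_inj (cut_timeK w)). Qed.

End Segments.

(** * The flag of a signed permutation *)

Section SegmentFlag.
Variable n : nat.
Implicit Types (p : signed_partition n) (w : 'S_n) (e : {ffun 'I_n -> bool}).
Implicit Types (i j c : 'I_n) (k : nat).

Definition segment_flag w e k : signed_partition n := splitting w e (cuts w k).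

Lemma segment_flag0 w e : segment_flag w e 0 = sp_bot n.
Proof.
by rewrite -(splitting_setT w e); congr splitting; apply/setP => i; rewrite !inE.
Qed.

Lemma segment_flagn w e : segment_flag w e n = sp_top n.
Proof.
rewrite -(splitting_set0 w e); congr splitting.
by apply/setP => i; rewrite !inE leqNgt ltn_ord.
Qed.

Lemma segment_flag_rank w e k : k <= n -> sp_rank (segment_flag w e k) = k.
Proof. by move=> kn; rewrite sp_rank_splitting card_cuts // subKn. Qed.

Lemma segment_flag_zero w e k i :
  same_block (segment_flag w e k) ord0 (letter_at w i) = (seg_end w i < k).
Proof.
rewrite zero_splitting; apply/forall_inP/idP => [cuts_gt|ek c].
  rewrite ltnNge; apply/negP => ke; have : seg_start w i \in cuts w k.
    by rewrite inE cut_time_start.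
  by move/cuts_gt; rewrite ltnNge seg_start_le.
rewrite inE => kc; apply: leq_ltn_trans (seg_end_ge w i) _; apply: seg_end_lt.
apply: leq_trans ek (leq_trans kc _).
by rewrite -(seg_end_cut_time w c) seg_end_ge.
Qed.

Lemma segment_flag_linked w e k i : letter_time w i < k <= seg_end w i ->
  linked (segment_flag w e k) w e i (seg_end w i).
Proof.
move=> lke; have ne := letter_time_lt_neq lke; case/andP: lke => lk ke.
rewrite linked_splitting; apply/forall_inP => c; rewrite inE => kc.
case: (leqP c i) => ci; first by rewrite (leq_trans ci (seg_end_ge w i)).
rewrite eq_sym; apply/eqP/negbTE; rewrite -ltnNge ltnNge; apply/negP => ce.
have Ec : seg_end w c = seg_end w i by apply: seg_end_eq; rewrite (ltnW ci).
move: kc lk; rewrite letter_timeE //= Ec (seg_start_eq Ec).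
by have := seg_start_le w i; have := seg_end_ge w i; lia.
Qed.

Lemma segment_flag_max_block w e i j :
  same_block (segment_flag w e (cut_time w i))
    (letter_at w j) (letter_at w (seg_end w i)) = (i <= j <= seg_end w i).
Proof.
rewrite same_splitting; apply/forall_inP/idP => [same_cuts|/andP[ij je] c].
  have := same_cuts i; rewrite inE leqnn seg_end_ge => /(_ isT)/eqP-> /=.
  rewrite leqNgt; apply/negP => ej.
  have cut_j : seg_start w j \in cuts w (cut_time w i).
    rewrite inE cut_time_start; apply: ltnW; apply: leq_trans (seg_end_ge w j).
    by apply: leq_ltn_trans ej; rewrite -(seg_end_cut_time w i) seg_end_ge.
  by have := same_cuts _ cut_j; rewrite seg_start_le leqNgt segment_lt.
rewrite inE => ic; have [cj|jc] := leqP c j; first by rewrite (leq_trans cj je).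
rewrite eq_sym; apply/eqP/negbTE; apply: contraL ic => ce; rewrite -ltnNge /=.
have Ec : seg_end w c = seg_end w i.
  by apply: seg_end_eq; rewrite ce (leq_trans ij (ltnW jc)).
by rewrite Ec (seg_start_eq Ec); have := seg_start_le w i; lia.
Qed.

Lemma segment_flag_le w e k p :
  (forall i, seg_end w i < k -> same_block p ord0 (letter_at w i)) ->
  (forall i, letter_time w i < k <= seg_end w i ->
    linked p w e i (seg_end w i)) ->
  (segment_flag w e k <= p)%O.
Proof.
move=> zero link.
apply: splitting_le => [i j ji|i i0]; rewrite inE -ltnNge => cut_k.
  have [je|ej] := leqP j (seg_end w i); last first.
    have ie := seg_end_ge w i; have js := segment_lt ej; have sj := seg_start_le w j.
    have {js sj} sj : seg_start w j = j by apply: val_inj => /=; lia.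
    rewrite -sj cut_time_start in cut_k.
    by apply: related_zero; apply: zero => //; have := seg_end_ge w j; lia.
  have Ej : seg_end w j = seg_end w i by apply: seg_end_eq; rewrite ji leqnSn -ji.
  have ti : letter_time w i < k by rewrite -(cut_time_succ ji je).
  have [ke|ek] := leqP k (seg_end w i); last first.
    by apply: related_zero; apply: zero; rewrite ?Ej.
  apply: (linked_trans (link i _)); first by rewrite ti.
  rewrite linked_sym -Ej; have [<-|nej] := eqVneq j (seg_end w j).
    exact: linked_refl.
  apply: link; rewrite Ej ke letter_timeE // Ej (seg_start_eq Ej).
  by move: cut_k; rewrite /= Ej (seg_start_eq Ej); lia.
apply: zero; have s0 : seg_start w i = i.
  by apply: ord_inj; have := seg_start_le w i; rewrite i0; lia.
by rewrite -s0 cut_time_start in cut_k.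
Qed.

Lemma segment_flag_eq w e k p : sp_rank p = k -> k <= n ->
  (forall i, seg_end w i < k -> same_block p ord0 (letter_at w i)) ->
  (forall i, letter_time w i < k <= seg_end w i ->
    linked p w e i (seg_end w i)) ->
  p = segment_flag w e k.
Proof.
move=> rank_p kn zero link; apply/esym/sp_rank_eq; first exact: segment_flag_le.
by rewrite segment_flag_rank.
Qed.

Lemma segment_flag_rep_late w e k i :
  letter_at w i \in block_reps (segment_flag w e k) -> k <= letter_time w i.
Proof.
move=> rep_i; rewrite leqNgt; apply/negP => tk.
have [ke|ek] := leqP k (seg_end w i); last first.
  by have := block_reps_zero rep_i; rewrite segment_flag_zero ek.
have tke : letter_time w i < k <= seg_end w i by rewrite tk.
have nzi : ~~ same_block (segment_flag w e k) ord0 (letter_at w i).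
  by rewrite segment_flag_zero -leqNgt.
have := block_repsP nzi rep_i _ (linked_same (segment_flag_linked e tke)).
rewrite /= ltnS => le_end; have := letter_time_lt_neq tke.
by rewrite -(inj_eq (@perm_inj _ w)) -val_eqE eqn_leq le_end seg_end_max.
Qed.

Lemma segment_flag_reps w e k i : k <= n ->
  (letter_at w i \in block_reps (segment_flag w e k)) = (k <= letter_time w i).
Proof.
move=> kn; pose late := [set letter_at w j | j : 'I_n & k <= letter_time w j].
suff -> : block_reps (segment_flag w e k) = ord0 |: late.
  by rewrite !inE /= (mem_imset _ _ (@letter_at_inj n w)) inE.
have card_late : #|late| = n - k.
  rewrite card_imset; last exact: letter_at_inj.
  exact: card_ord_geq_inj (can_inj (letter_timeK w)) kn.
have notin0 : ord0 \notin late by apply/imsetP => -[].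
apply/eqP; rewrite eqEcard cardsU1 notin0 card_late.
rewrite card_block_reps_splitting card_cuts // leqnn andbT.
apply/subsetP => a; rewrite in_setU1; case: (letter_atP w a) => [|j] // rep_j.
by apply/orP; right; apply: imset_f; rewrite inE (segment_flag_rep_late rep_j).
Qed.

End SegmentFlag.

Section FirstSegment.
Variable m : nat.
Local Notation n := m.+2.
Implicit Types (w : 'S_n) (e : {ffun 'I_n -> bool}) (i : 'I_n) (k : nat).

Lemma cuts_admissible w k : 0 < seg_end w ord0 -> admissible (cuts w k).
Proof.
move=> b_gt0; apply/forall_inP => i; rewrite inE => ki.
apply/implyP => /forall_inP i_min; apply/eqP => i1.
have Ei : seg_end w i = seg_end w ord0 by apply: seg_end_eq; rewrite i1.
have s0 : seg_start w ord0 = ord0 by apply/val_inj/eqP; rewrite -leqn0 seg_start_le.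
suff /i_min : ord0 \in cuts w k by rewrite i1.
rewrite inE (leq_trans ki) //= Ei (seg_start_eq Ei) s0 subn0.
exact: leq_subr.
Qed.

Lemma segment_flag_is_flag (B : {set signed_partition n}) w e :
  0 < seg_end w ord0 ->
  (forall S, admissible S -> splitting w e S \in B) ->
  flag B n (sp_bot n) (sp_top n) (segment_flag w e).
Proof.
move=> b_gt0 inB; split=> [k _|k kn||].
- exact/inB/cuts_admissible.
- rewrite lt_neqAle; apply/andP; split.
    apply/eqP => /(congr1 (@sp_rank n)).
    by rewrite !segment_flag_rank ?(ltnW kn) //; lia.
  by apply/splittingS/subsetP => i; rewrite !inE; apply: ltnW.
- exact: segment_flag0.
- exact: segment_flagn.
Qed.

Lemma segment_flag1_PiD w e : segment_flag w e 1 \in PiD n -> 0 < seg_end w ord0.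
Proof.
rewrite in_PiD lt0n; apply: contraNneq => b0.
rewrite (_ : [set a | _] = [set ord0; letter_at w ord0]) ?cards2 //.
apply/setP => a; rewrite !inE.
case: (letter_atP w a) => [|i]; first by rewrite same_refl.
rewrite segment_flag_zero ltnS leqn0 (inj_eq (@letter_at_inj n w)) /=.
apply/idP/eqP => [ei|->]; last by rewrite b0.
by apply/val_inj/eqP; rewrite -leqn0 -(eqP ei) seg_end_ge.
Qed.

End FirstSegment.

(** * Flags all of whose steps touch the block of the largest letter *)

Section GoodFlags.
Variable m : nat.
Local Notation n := m.+2.
Local Notation flagD := (flag (PiD n) n (sp_bot n) (sp_top n)).
Implicit Types (p q : signed_partition n) (w v : 'S_n) (e : {ffun 'I_n -> bool}).
Implicit Types (i k : 'I_n) (l : nat) (F : nat -> signed_partition n).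

Definition unbarred_maxima w e : Prop := forall i, seg_end w i = i -> e i = false.

(* The unused first argument is the step, on which bad steps may depend in
   [good_below]. *)
Definition idle (_ : nat) p q : bool := keeps_block (max_nonzero p) p q.

Lemma flagD_rank F l : flagD F -> l <= n -> sp_rank (F l) = l.
Proof. exact: (flag_rank (graded_PiD m)). Qed.

Lemma removal_perm F : flagD F -> exists v, forall k l, l <= n ->
  (letter_at v k \in block_reps (F l)) = (l <= k).
Proof.
move=> flF; have /fin_all_exists[r rP] : forall k, exists r,
    [/\ r != ord0, r \in block_reps (F k)
      & block_reps (F k.+1) = block_reps (F k) :\ r].
  move=> k; apply: cover_block_reps; first by rewrite (flag_le flF) // leqnSn ltn_ord.
  by rewrite !flagD_rank // ltnW.
have r_reps k l : l <= n -> (r k \in block_reps (F l)) = (l <= k).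
  have [_ rk reps_k1] := rP k => ln; case: leqP => kl.
    by apply: (subsetP (le_block_reps _)) rk; rewrite (flag_le flF) // kl ltnW.
  have sub : block_reps (F l) \subset block_reps (F k.+1).
    by rewrite le_block_reps // (flag_le flF) // kl.
  by apply/negbTE/negP => /(subsetP sub); rewrite reps_k1 !inE eqxx.
have r_le k k' : r k = r k' -> k <= k'.
  by move=> E; have := r_reps k k (ltnW (ltn_ord k)); rewrite E r_reps ?leqnn // ltnW.
have r_inj : injective r.
  by move=> k k' E; apply/val_inj/eqP; rewrite eqn_leq !r_le.
have /fin_all_exists[pos r_pos] : forall k, exists x, r k = lift ord0 x.
  move=> k; have [r0 _ _] := rP k.
  by case: (unliftP ord0 (r k)) r0 => [x ->|->//] _; exists x.
have pos_inj : injective pos by move=> k k' E; apply: r_inj; rewrite !r_pos E.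
by exists (perm pos_inj) => k l; rewrite permE -r_pos; apply: r_reps.
Qed.

Section RemovalOrder.
Variables (F : nat -> signed_partition n) (v : 'S_n).
Hypotheses (flF : flagD F) (good_F : good_below idle n F).
Hypothesis reps_F : forall k l, l <= n ->
  (letter_at v k \in block_reps (F l)) = (l <= k).

Lemma removed_nonzero k l : l <= k -> ~~ same_block (F l) ord0 (letter_at v k).
Proof. by move=> lk; rewrite block_reps_zero // reps_F // (leq_trans lk) // ltnW. Qed.

Lemma max_nonzero_removal k : max_nonzero (F k) = letter_at v (seg_end v k).
Proof.
have kn : k <= n := ltnW (ltn_ord k).
have rank_k : sp_rank (F k) < n by rewrite flagD_rank.
have [nzu u_max] := max_nonzeroP rank_k; have := max_nonzero_rep rank_k.
case: (letter_atP v (max_nonzero (F k))) nzu u_max => [|i _ i_max].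
  by rewrite same_refl.
rewrite reps_F // => ki.
have := i_max _ (removed_nonzero (seg_end_ge v k)); rewrite /= !ltnS => le_i.
congr (letter_at v _); apply/esym/seg_end_uniq => // j kj.
exact: leq_trans (seg_end_max v kj) le_i.
Qed.

Lemma removed_end_zero k :
  seg_end v k = k -> same_block (F k.+1) ord0 (letter_at v k).
Proof.
move=> end_k; apply: contraT => nz.
have := block_rep_max nz (same_refl _ _).
have := block_rep_in (F k.+1) (letter_at v k).
have := same_block_rep (F k.+1) (letter_at v k).
case: (letter_atP v (block_rep _ _)) => [|i _]; first by rewrite same_sym (negbTE nz).
rewrite reps_F // => ki; rewrite /= ltnS => le_i.
have := seg_end_max v (ltnW ki); rewrite end_k => ge_i.
have /perm_inj E : v k = v i by apply/val_inj/eqP; rewrite eqn_leq le_i.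
by rewrite E ltnn in ki.
Qed.

Lemma removed_merged k : k != seg_end v k ->
  same_block (F k.+1) (letter_at v k) (letter_at v (seg_end v k)).
Proof.
move=> ne; set r := letter_at v k; set u := letter_at v (seg_end v k).
have kn := ltn_ord k; have le_F : (F k <= F k.+1)%O.
  by rewrite (flag_le flF) // leqnSn.
have rank_F : sp_rank (F k.+1) = (sp_rank (F k)).+1 by rewrite !flagD_rank // ltnW.
have := good_F kn; rewrite /idle max_nonzero_removal negb_forall => /existsP[a].
rewrite negb_imply => /andP[ua nua].
pose t := block_rep (F k.+1) r.
have rt : same_block (F k.+1) r t := same_block_rep _ _.
have r_rep : r \in block_reps (F k) by rewrite reps_F // ltnW.
have u_rep : u \in block_reps (F k) by rewrite reps_F ?seg_end_ge // ltnW.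
have nrt : ~~ same_block (F k) r t.
  apply/negP => /(block_reps_inj r_rep) E.
  have : r \in block_reps (F k.+1).
    by rewrite E ?block_rep_in // (subsetP (le_block_reps le_F)) // block_rep_in.
  by rewrite reps_F // ltnn.
have := cover_merges_one_pair le_F rank_F ua nua rt nrt.
case/orP=> /andP[ur _].
  by have /letter_at_inj E := block_reps_inj u_rep r_rep ur; rewrite E eqxx in ne.
by rewrite same_sym (same_eql _ (le_same le_F ur)) same_sym.
Qed.

Let w := (letter_perm v * v)%g.

(* The relative sign with which the letter of position [i] joins the largest
   letter of its segment. *)
Definition merge_sign : {ffun 'I_n -> bool} := [ffun i => let k := letter_time v i in
  (i != seg_end v i) && (barred (F k.+1) (letter_at v k) (+)
                         barred (F k.+1) (letter_at v (seg_end v k)))].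

Lemma letter_at_removal i : letter_at w i = letter_at v (letter_time v i).
Proof. by rewrite /w permM permE. Qed.

Lemma letter_at_removal_end i : letter_at w (seg_end v i) = letter_at v (seg_end v i).
Proof. by rewrite letter_at_removal letter_time_id. Qed.

Lemma joins_segment_end i l : letter_time v i < l <= seg_end v i -> l <= n ->
  linked (F l) w merge_sign i (seg_end v i).
Proof.
move=> tl ln; have ne := letter_time_lt_neq tl; have [til lte] := andP tl.
have ne_t : letter_time v i != seg_end v (letter_time v i).
  by rewrite seg_end_letter_time -val_eqE ltn_eqF // letter_time_lt.
have := same_related (removed_merged ne_t).
rewrite /linked letter_at_removal letter_at_removal_end.
have -> : merge_sign (seg_end v i) = false by rewrite ffunE seg_endK eqxx.
rewrite addbF ffunE ne /= seg_end_letter_time; apply: le_related.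
by rewrite (flag_le flF) // til.
Qed.

Lemma joins_zero_block i l :
  seg_end v i < l <= n -> same_block (F l) ord0 (letter_at w i).
Proof.
move=> /andP[el ln]; have end_n : seg_end v i <= n := ltnW (ltn_ord _).
have end_zero : same_block (F l) ord0 (letter_at w (seg_end v i)).
  rewrite letter_at_removal_end; apply: (le_same _ (removed_end_zero (seg_endK v i))).
  by rewrite (flag_le flF) // el.
have [E|ne] := eqVneq i (seg_end v i); first by rewrite {1}E.
have t_end : letter_time v i < seg_end v i <= seg_end v i.
  by rewrite letter_time_lt ?leqnn.
have le_F : (F (seg_end v i) <= F l)%O by rewrite (flag_le flF) // (ltnW el).
have joined := linked_same (joins_segment_end t_end end_n).
by rewrite (same_eqr _ (le_same le_F joined)).
Qed.

Lemma good_flag_eq l : l <= n -> F l = segment_flag w merge_sign l.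
Proof.
move=> ln; apply: segment_flag_eq; rewrite ?flagD_rank // => i.
all: rewrite /w ?letter_time_letter_perm seg_end_letter_perm => el.
  by apply: joins_zero_block; rewrite el.
exact: joins_segment_end.
Qed.

End RemovalOrder.

Lemma good_flag_segment_flag F : flagD F -> good_below idle n F -> exists w e,
  [/\ forall l, l <= n -> F l = segment_flag w e l, unbarred_maxima w e
    & 0 < seg_end w ord0].
Proof.
move=> flF good_F; have [v reps_F] := removal_perm flF.
have FE := good_flag_eq flF good_F reps_F.
exists (letter_perm v * v)%g, (merge_sign F v); split=> // [i|].
  by rewrite seg_end_letter_perm ffunE => ->; rewrite eqxx.
apply: (@segment_flag1_PiD _ _ (merge_sign F v)); rewrite -FE //.
by have [inB _ _ _] := flF; apply: inB.
Qed.

End GoodFlags.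

Arguments idle {m}.

(** * A cycle is determined by its values on the flags of the basis *)

Section FirstSegmentCover.
Variable m : nat.
Local Notation n := m.+2.
Implicit Types (p q : signed_partition n) (e : {ffun 'I_n -> bool}).
Implicit Types (i j : 'I_n) (k : nat).

Lemma negate_first_ord0 e : negate_first e ord0 = ~~ e ord0.
Proof. by rewrite ffunE. Qed.

Lemma negate_firstE e i : 0 < i -> negate_first e i = e i.
Proof. by rewrite ffunE lt0n => /negbTE->. Qed.

Lemma linked_negate_first p (w : 'S_n) e i j : 0 < i -> 0 < j ->
  linked p w (negate_first e) i j = linked p w e i j.
Proof. by move=> i0 j0; rewrite /linked !negate_firstE. Qed.

Lemma perm_seg_end_ord0 (w : 'S_n) : w (seg_end w ord0) = ord_max.
Proof.
apply/val_inj/eqP; rewrite eqn_leq -ltnS ltn_ord /=.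
by have := @seg_end_max _ w ord0 ((w^-1)%g ord_max) isT; rewrite permKV.
Qed.

Variable w : 'S_n.
Let b := seg_end w ord0.
Hypothesis b_gt0 : 0 < b.

Lemma first_seg_start i : i <= b -> seg_start w i = ord0.
Proof.
move=> ib; have Ei : seg_end w i = seg_end w ord0 by apply: seg_end_eq.
by rewrite (seg_start_eq Ei); apply/val_inj/eqP; rewrite -leqn0 seg_start_le.
Qed.

Lemma first_seg_end i : seg_start w i <= b -> seg_end w i = b.
Proof. by move=> sb; rewrite -seg_end_start; apply: seg_end_eq. Qed.

Lemma first_letter_time i : i < b -> letter_time w i = b - i.+1 :> nat.
Proof.
move=> ib; have s0 := first_seg_start (ltnW ib).
have end_i : seg_end w i = b by apply: first_seg_end; rewrite s0.
by rewrite letter_timeE end_i ?s0 // -val_eqE ltn_eqF.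
Qed.

Lemma last_first_letters i : b.-1 <= letter_time w i <= b -> i = ord0 \/ i = b.
Proof.
case/andP=> lo hi; have : letter_time w i = b \/ letter_time w i = letter_time w ord0.
  have [|ne] := eqVneq (letter_time w i) b; [by left|right].
  apply: ord_inj; rewrite [RHS]first_letter_time // subn1.
  by have {}ne : letter_time w i != b :> nat := ne; lia.
case=> [E|/(can_inj (letter_timeK w))]; [right|by left].
by rewrite -[LHS](letter_timeK w) E letter_time_id.
Qed.

Section Between.
Variables (e : {ffun 'I_n -> bool}) (q : signed_partition n).
Hypothesis q_ge : (segment_flag w e b.-1 <= q)%O.
Hypothesis q_le : (q <= segment_flag w e b.+1)%O.
Hypotheses (q_PiD : q \in PiD n) (q_rank : sp_rank q = b).
Hypothesis nzb : ~~ same_block q ord0 (letter_at w b).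

Lemma linked_to_max i : 0 < i -> i < b -> linked q w e i b.
Proof.
move=> i0 ib; apply: (linked_le q_ge); have end_i : seg_end w i = b.
  by apply: first_seg_end; rewrite first_seg_start // ltnW.
rewrite -[X in linked _ _ _ _ X]end_i; apply: segment_flag_linked.
by rewrite end_i first_letter_time //; lia.
Qed.

Lemma first_letter_nonzero : ~~ same_block q ord0 (letter_at w ord0).
Proof.
move: q_PiD; rewrite in_PiD; apply: contra => z0.
rewrite (_ : [set a | _] = [set ord0; letter_at w ord0]) ?cards2 //.
apply/setP => a; rewrite !inE.
case: (letter_atP w a) => [|i]; first by rewrite same_refl.
rewrite (inj_eq (@letter_at_inj n w)) /=; have [->//|] := eqVneq i ord0.
rewrite -ord_gt0 => i0.
apply/negbTE/negP => zi; have ib : i <= b.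
  rewrite -ltnS; apply: leq_ltn_trans (seg_end_ge w i) _.
  by rewrite -(segment_flag_zero w e) (le_same q_le zi).
case/negP: nzb; move: ib; rewrite leq_eqVlt => /predU1P[/val_inj<-//|ib].
by rewrite -(same_eqr _ (linked_same (linked_to_max i0 ib))).
Qed.

Lemma first_letter_merged : same_block q (letter_at w ord0) (letter_at w b).
Proof.
have b1n : b.-1 <= n by apply: leq_trans (leq_pred _) (ltnW (ltn_ord b)).
have rank_p : sp_rank q = (sp_rank (segment_flag w e b.-1)).+1.
  by rewrite segment_flag_rank // prednK.
have [r [r0 rp reps_q]] := cover_block_reps q_ge rank_p.
have ends j : letter_at w j \in block_reps (segment_flag w e b.-1) ->
    letter_time w j <= b -> j = ord0 \/ j = b.
  by rewrite segment_flag_reps // => lo hi; apply: last_first_letters; rewrite lo.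
case: (letter_atP w r) r0 rp reps_q => [|i _ ri reps_q]; first by rewrite eqxx.
have nri : letter_at w i \notin block_reps q by rewrite reps_q !inE eqxx.
have ti : letter_time w i <= b.
  rewrite leqNgt; apply: contra nri => bi.
  by apply: (subsetP (le_block_reps q_le)); rewrite segment_flag_reps //.
have nzi : ~~ same_block q ord0 (letter_at w i).
  by case: (ends i ri ti) => ->; [exact: first_letter_nonzero|].
have := same_block_rep q (letter_at w i); have := block_rep_in q (letter_at w i).
case: (letter_atP w (block_rep q _)) => [|j rj ij].
  by rewrite same_sym (negbTE nzi).
have zi : same_block (segment_flag w e b.+1) ord0 (letter_at w i).
  rewrite segment_flag_zero ltnS.
  by case: (ends i ri ti) => ->; rewrite // seg_endK.
have tj : letter_time w j <= b.
  apply: leq_trans (letter_time_le w j) _.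
  by rewrite -ltnS -(segment_flag_zero w e) -(same_eqr _ (le_same q_le ij)).
have rj' := subsetP (le_block_reps q_ge) _ rj.
case: (ends i ri ti) (ends j rj' tj) ij nri rj => -> [] -> // ij nri rj.
- by rewrite rj in nri.
- by rewrite same_sym.
- by rewrite rj in nri.
Qed.

Lemma first_segment_cover :
  q = segment_flag w e b \/ q = segment_flag w (negate_first e) b.
Proof.
have ext e' : (forall i, 0 < i -> e' i = e i) -> linked q w e' ord0 b ->
    q = segment_flag w e' b.
  move=> e'E link0; apply: segment_flag_eq => // [|i|i /andP[ti _]].
  - exact/ltnW/ltn_ord.
  - by rewrite ltnNge seg_end_mono.
  have end_i : seg_end w i = b.
    by apply: first_seg_end; apply: leq_trans (seg_start_letter_time w i) (ltnW ti).
  rewrite end_i; have [->//|] := eqVneq i ord0; rewrite -ord_gt0 => i0.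
  have ib : i < b.
    rewrite -end_i lt_seg_end //; apply: contraTneq ti => E.
    by rewrite {1}E letter_time_id end_i ltnn.
  by have := linked_to_max i0 ib; rewrite /linked !e'E.
have [link|unlink] := boolP (linked q w e ord0 b); first by left; apply: ext.
right; apply: ext; first exact: negate_firstE.
move: unlink; rewrite /linked /related first_letter_merged.
rewrite (negbTE first_letter_nonzero) negate_first_ord0 (negate_firstE _ b_gt0).
rewrite addNb /=.
by case: (_ (+) barred _ _); case: (e ord0 (+) e b).
Qed.

End Between.

Lemma segment_flag_negate_first e k : k != b -> k <= n ->
  segment_flag w e k = segment_flag w (negate_first e) k.
Proof.
move=> kb kn; apply: segment_flag_eq; rewrite ?segment_flag_rank // => i.
  by rewrite segment_flag_zero.
move=> tk; have := segment_flag_linked e tk; case: (posnP i) => [i0|i0]; last first.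
  by rewrite linked_negate_first // (leq_trans i0 (seg_end_ge w i)).
have {i0} E : i = ord0 by apply: val_inj.
by move: tk kb; rewrite E first_letter_time // -/b subn1; lia.
Qed.

End FirstSegmentCover.

Section BasisIndex.
Variable m : nat.
Local Notation n := m.+2.
Implicit Types (x : Dn n) (e : {ffun 'I_n -> bool}).

Lemma basis_indexP x :
  reflect (0 < seg_end x.1 ord0 /\ unbarred_maxima x.1 x.2) (basis_index x).
Proof.
have firstE : (0 < seg_end x.1 ord0) = (x.1 ord0 != m.+1 :> nat).
  have end_max := perm_seg_end_ord0 x.1; rewrite ord_gt0; congr (~~ _).
  apply/eqP/eqP => [b0|w0]; first by rewrite -[in LHS]b0 end_max.
  by apply: (@perm_inj _ x.1); rewrite end_max; apply: val_inj.
apply: (iffP andP) => [[/forallP first_max /forallP unbarred]|[first_max unbarred]].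
  split=> [|i end_i]; first by rewrite firstE; apply: (implyP (first_max ord0)).
  by apply/negbTE; apply: (implyP (unbarred i)); rewrite rtl_maxE end_i.
split; apply/forallP => i; apply/implyP.
  by move=> /eqP i0; rewrite (_ : i = ord0) -?firstE //; apply: val_inj.
by rewrite rtl_maxE => /eqP/unbarred->.
Qed.

Lemma odd_bars_first e :
  odd #|[set i | e i]| = e ord0 (+) odd #|[set i | e i] :\ ord0|.
Proof. by rewrite (cardsD1 ord0) inE oddD oddb. Qed.

Lemma odd_bars_negate_first e :
  odd #|[set i | negate_first e i]| = ~~ odd #|[set i | e i]|.
Proof.
rewrite !odd_bars_first negate_first_ord0 addNb.
congr (~~ (_ (+) odd #|pred_of_set _|)); apply/setP => i; rewrite !inE.
by have [//|i0] := eqVneq i ord0; rewrite negate_firstE // ord_gt0.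
Qed.

End BasisIndex.

Section Vanishing.
Variable m : nat.
Local Notation n := m.+2.
Local Notation flagD := (flag (PiD n) n (sp_bot n) (sp_top n)).
Implicit Types (p q : signed_partition n) (w : 'S_n) (e : {ffun 'I_n -> bool}).
Implicit Types (F : nat -> signed_partition n) (k j t : nat).

Lemma idle_top F k : flagD F -> k < n -> ~~ idle k (F k) (sp_top n).
Proof.
move=> flF kn; have rank_k : sp_rank (F k) < n by rewrite flagD_rank // ltnW.
have [nzu _] := max_nonzeroP rank_k.
by apply: zero_touches_block => //; apply: zero_splitting_set0.
Qed.

Lemma idle_unique F j k q : flagD F -> flagD (update F j q) -> k < j < n ->
  idle k (F k) (F j) -> idle k (F k) q -> ~~ idle k (F k) (F j.+1) -> q = F j.
Proof.
move=> flF flq /andP[kj jn]; have qE := update_same F j q.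
have pE : update F j q k = F k by rewrite update_other // ltn_eqF.
have rE : update F j q j.+1 = F j.+1 by rewrite update_other // gtn_eqF.
have rank_k : sp_rank (F k) < n by rewrite flagD_rank //; lia.
have [nzu _] := max_nonzeroP rank_k.
move=> idle_F idle_q touch; apply: (keeps_block_uniq nzu) idle_q idle_F touch.
- by rewrite -qE -pE (flag_le flq) //; lia.
- by rewrite (flag_le flF) //; lia.
- by rewrite -{1}qE -rE (flag_le flq) //; lia.
- by rewrite (flag_le flF) //; lia.
- by rewrite -{1}qE !flagD_rank //; lia.
- by rewrite !flagD_rank //; lia.
Qed.

Variable z : {ffun {set signed_partition n} -> int}.
Hypothesis z_chain : is_chain (proper_part (PiD n)) n.-1 z.
Hypothesis z_cycle : boundary z = 0%R.

Lemma vanish_from_good (P : (nat -> signed_partition n) -> Prop) i0 : i0 <= n ->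
  (forall F j q, i0 < j -> P F -> P (update F j q)) ->
  (forall F, flagD F -> P F -> good_below idle n F -> z (facet n F) = 0%R) ->
  forall F, flagD F -> P F -> good_below idle i0 F -> z (facet n F) = 0%R.
Proof.
move=> i0n P_update good0 F flF PF gF; apply/eqP; rewrite -dvd0z.
apply: (dvd_from_good (graded_PiD m) z_chain z_cycle _ _ P_update i0n _ flF PF gF).
- exact: idle_top.
- by move=> G j k q flG flq kj _; apply: idle_unique.
- by move=> G flG PG gG; rewrite dvd0z; apply/eqP/good0.
Qed.

Hypothesis z_basis : forall x : Dn n,
  basis_index x -> z (facet n (segment_flag x.1 x.2)) = 0%R.

Lemma even_segment_flag_vanish w e : 0 < seg_end w ord0 -> unbarred_maxima w e ->
  ~~ odd #|[set i | e i]| -> z (facet n (segment_flag w e)) = 0%R.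
Proof.
move=> b_gt0 e_max even_e; pose x := DnElt (Dn_pair := (w, e)) even_e.
by apply: (z_basis (x := x)); apply/basis_indexP.
Qed.

Lemma letter_at_seg_end_ord0 w : letter_at w (seg_end w ord0) = ord_max.
Proof. by apply: val_inj; rewrite perm_seg_end_ord0. Qed.

Lemma zero_ord_max w e k :
  same_block (segment_flag w e k) ord0 ord_max = (seg_end w ord0 < k).
Proof. by rewrite -(letter_at_seg_end_ord0 w) segment_flag_zero seg_endK. Qed.

Lemma max_nonzero_ord_max p : ~~ same_block p ord0 ord_max -> sp_rank p < n ->
  max_nonzero p = ord_max.
Proof.
move=> nz /max_nonzeroP[_ u_max]; apply/val_inj/eqP.
by rewrite eqn_leq u_max // andbT -ltnS ltn_ord.
Qed.

(* The exchange at step [b], where the letter [n] is about to enter the zero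
   block, pairs [e] with [negate_first e] up to flags in which [n] enters the
   zero block one step earlier. *)
Lemma odd_segment_flag_vanish w e F (b := seg_end w ord0) :
  flagD F -> good_below idle n F -> (forall k, k <= n -> F k = segment_flag w e k) ->
  0 < b -> unbarred_maxima w e -> odd #|[set i | e i]| ->
  (forall G, flagD G -> good_below idle b G -> same_block (G b) ord0 ord_max ->
     z (facet n G) = 0%R) ->
  z (facet n F) = 0%R.
Proof.
move=> flF gF FE b_gt0 e_max odd_e early0; have bn : 0 < b < n.
  by rewrite b_gt0 ltn_ord.
have [b1n b2n] : b.-1 <= n /\ b <= n by lia.
rewrite (cycle_flag_exchange (graded_PiD m) z_chain z_cycle flF bn).
rewrite big1 ?oppr0 // => q /and3P[qD lq qF]; have flq := flag_update flF bn qD lq.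
have [zq|nzq] := boolP (same_block q ord0 ord_max).
  apply: early0 flq _ _; last by rewrite update_same.
  move=> k kb; rewrite update_other ?ltn_eqF //.
  have [k1b|k1b] := eqVneq k.+1 b; last by rewrite update_other //; apply: gF; lia.
  have kn : k < n by lia.
  have rank_k : sp_rank (F k) < n by rewrite flagD_rank // ltnW.
  have nzk : ~~ same_block (F k) ord0 ord_max.
    by rewrite FE ?zero_ord_max -?leqNgt // ltnW.
  by rewrite k1b update_same /idle max_nonzero_ord_max // zero_touches_block.
have rank_q : sp_rank q = b by rewrite -{1}(update_same F b q) flagD_rank.
case/andP: lq => /ltW + /ltW; rewrite !FE // => q_ge q_le.
have := first_segment_cover b_gt0 q_ge q_le qD rank_q.
rewrite letter_at_seg_end_ord0 => /(_ nzq) []qE; first by rewrite qE FE ?eqxx in qF.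
rewrite (@eq_facet _ _ _ _ (segment_flag w (negate_first e))).
  apply: even_segment_flag_vanish; rewrite ?odd_bars_negate_first ?odd_e // => i end_i.
  rewrite negate_firstE ?e_max // ord_gt0; apply: contraTneq b_gt0 => i0.
  by rewrite /b -i0 end_i i0.
move=> k kn; have [->|kb] := eqVneq k b; first by rewrite update_same.
by rewrite update_other // FE // segment_flag_negate_first.
Qed.

Lemma vanish_zero_by t : t <= n -> forall F, flagD F -> good_below idle t F ->
  same_block (F t) ord0 ord_max -> z (facet n F) = 0%R.
Proof.
elim: t => [|t IH] tn F flF gF zF.
  have [_ _ F0 _] := flF.
  by rewrite F0 -(segment_flag0 1 [ffun=> false]) zero_ord_max in zF.
have [zt|nzt] := boolP (same_block (F t) ord0 ord_max).
  by apply: (IH (ltnW tn)) zt => // k kt; apply: gF; apply: ltnW.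
pose P (G : nat -> signed_partition n) :=
  same_block (G t.+1) ord0 ord_max /\ ~~ same_block (G t) ord0 ord_max.
apply: (vanish_from_good (P := P) (i0 := t.+1)) flF (conj zF nzt) gF => //.
  by move=> G j q tj [zG nzG]; rewrite /P !update_other // ltn_eqF // ltnW.
move=> {F zF nzt} F flF [zF nzF] gF.
have [w [e [FE e_max b_gt0]]] := good_flag_segment_flag flF gF.
have bt : seg_end w ord0 = t :> nat.
  by move: zF nzF; rewrite !FE ?zero_ord_max ?(ltnW tn) //; lia.
have [odd_e|even_e] := boolP (odd #|[set i | e i]|); last first.
  by rewrite (eq_facet FE) even_segment_flag_vanish.
apply: (odd_segment_flag_vanish flF gF FE) => //; rewrite bt.
exact: IH (ltnW tn).
Qed.

Lemma cycle_vanish : z = 0%R.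
Proof.
have facet0 F : flagD F -> z (facet n F) = 0%R.
  move=> flF; apply: (vanish_from_good (P := xpredT) (i0 := 0)) flF _ _ => //.
  move=> G flG _ gG; apply: (vanish_zero_by (leqnn n) flG) => //.
  by have [_ _ _ ->] := flG; apply: zero_splitting_set0.
apply/ffunP => A; rewrite [RHS]ffunE; apply/eqP; apply: contraT => nz.
have [//|F flF E] := support_flag (graded_PiD m) z_chain _ nz.
by rewrite E facet0 ?eqxx in nz.
Qed.

End Vanishing.

(** * The Boolean subposets *)

Section BooleanSubposet.
Variable m : nat.
Local Notation n := m.+2.
Local Notation pos1 := (lift ord0 ord0 : 'I_n).
Implicit Types (p q : signed_partition n) (w : 'S_n) (e : {ffun 'I_n -> bool}).
Implicit Types (S : {set 'I_n}) (i j c : 'I_n).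

Lemma negate_firstK : involutive (@negate_first n).
Proof. by move=> e; apply/ffunP => i; rewrite !ffunE addbA addbb. Qed.

(* The atoms join adjacent letters; the atom with index [0] joins the first two
   letters with the opposite relative sign. *)
Definition atoms_below w e p : {set 'I_n} :=
  [set i : 'I_n | if i == ord0 then linked p w (negate_first e) ord0 pos1
                  else linked p w e (ord_pred i) i].

Lemma ord_predE i : i != ord0 -> ord_pred i = i.-1 :> nat.
Proof.
rewrite -ord_gt0 => i0 /=; have -> : (i + n).-1 = i.-1 + n by lia.
by rewrite modnDr modn_small // (leq_ltn_trans (leq_pred i)).
Qed.

Lemma ord_pred_pos1 : ord_pred pos1 = ord0.
Proof. by apply: ord_inj; rewrite ord_predE. Qed.

Lemma atoms_belowS w e p q :
  (p <= q)%O -> atoms_below w e p \subset atoms_below w e q.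
Proof.
by move=> pq; apply/subsetP => i; rewrite !inE; case: ifP => _; apply: linked_le.
Qed.

Lemma linked_both_zero p w e : linked p w e ord0 pos1 ->
  linked p w (negate_first e) ord0 pos1 -> same_block p ord0 (letter_at w ord0).
Proof.
move=> link link'; apply: contraT => nz; have := related_uniq nz link link'.
by rewrite negate_first_ord0 negate_firstE //; case: (e ord0) (e pos1) => [] [].
Qed.

Lemma atoms_below_splitting w e S :
  admissible S -> atoms_below w e (splitting w e S) = ~: S.
Proof.
move=> adm; apply/setP => i; rewrite !inE; have [->|i0] := eqVneq i ord0.
  apply/idP/idP => [link|zS]; last by apply: related_zero; apply: admissible_zero.
  rewrite -(zero_splitting_first w e); apply: (linked_both_zero (e := e)) => //.
  by rewrite linked_splitting -(same_splitting w e) (linked_same link).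
rewrite linked_splitting; apply/forall_inP/idP => [no_cut|iS c cS].
  by apply/negP => /no_cut; rewrite ord_predE //; move: i0; rewrite -ord_gt0; lia.
have ic : c != i :> nat by apply: contraNneq iS => /val_inj <-.
by rewrite ord_predE //; move: i0; rewrite -ord_gt0; lia.
Qed.

Lemma atoms_below_negate_first w e p :
  atoms_below w (negate_first e) p = tperm ord0 pos1 @^-1: atoms_below w e p.
Proof.
apply/setP => i; rewrite !inE; case: tpermP => [->|->|/eqP i0 i1] /=.
- by rewrite negate_firstK ord_pred_pos1.
- by rewrite ord_pred_pos1.
have {}i1 : i != 1 :> nat by apply: contra_not_neq i1 => i1; apply: val_inj.
have i_gt0 : 0 < i by rewrite ord_gt0.
by rewrite (negbTE i0) linked_negate_first // ord_predE //; lia.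
Qed.

Lemma card_atoms_below_negate_first w e p :
  #|atoms_below w (negate_first e) p| = #|atoms_below w e p|.
Proof. by rewrite atoms_below_negate_first card_preimset //; apply: perm_inj. Qed.

Lemma splitting_le_atoms w e S q : admissible S ->
  atoms_below w e (splitting w e S) \subset atoms_below w e q ->
  (splitting w e S <= q)%O.
Proof.
move=> adm; rewrite atoms_below_splitting // => /subsetP sub.
have adj i : i \notin S -> i != ord0 -> linked q w e (ord_pred i) i.
  by move=> iS i0; have := sub i; rewrite !inE iS (negbTE i0) => /(_ isT).
apply: splitting_le => [i j ij jS|i i0 iS].
  have j0 : j != ord0 by rewrite -val_eqE /= ij.
  by rewrite (_ : i = ord_pred j) ?adj //; apply: ord_inj; rewrite ord_predE // ij.
have {i0} E : i = ord0 by apply: val_inj.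
rewrite E in iS *; apply: (@linked_both_zero q w e).
  rewrite -[X in linked _ _ _ X _]ord_pred_pos1; apply: adj => //.
  apply/negP => S1; have := @admissible_zero _ w e S pos1 adm iS (leqnn 1).
  by rewrite zero_splitting => /forall_inP/(_ _ S1); rewrite ltnn.
by have := sub ord0; rewrite !inE iS => /(_ isT).
Qed.

Lemma tPiP w e p : p \in tPi w e -> exists2 S, admissible S &
  p = splitting w e S \/ p = splitting w (negate_first e) S.
Proof.
rewrite inE => /andP[_ /existsP[S /andP[adm]]].
by case/orP=> /eqP->; exists S => //; [left|right].
Qed.

Lemma splitting_tPi w e S : admissible S -> splitting w e S \in tPi w e.
Proof.
move=> adm; rewrite inE admissible_PiD //=; apply/existsP; exists S.
by rewrite adm eqxx.
Qed.

Lemma tPi_le_atoms w e : {in tPi w e &, forall p q,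
  (p <= q)%O = (atoms_below w e p \subset atoms_below w e q)}.
Proof.
move=> p q pT _; apply/idP/idP => [|sub]; first exact: atoms_belowS.
case/tPiP: pT sub => S adm [->|->]; first exact: splitting_le_atoms.
move=> /(preimsetS (tperm ord0 pos1)); rewrite -!atoms_below_negate_first.
exact: splitting_le_atoms.
Qed.

Lemma card_atoms_below w e : {in tPi w e, forall p, #|atoms_below w e p| = sp_rank p}.
Proof.
move=> p /tPiP[S adm [->|->]]; last rewrite -card_atoms_below_negate_first.
all: by rewrite atoms_below_splitting // cardsCs setCK card_ord sp_rank_splitting.
Qed.

Lemma graded_tPi w e : graded (tPi w e) n (@sp_rank n) (sp_bot n) (sp_top n).
Proof.
have [homo [_ bot_le rk_bot] [_ le_top rk_top]] := graded_PiD m.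
have sub := subsetP (tPi_sub w e).
split=> //; split=> // [|p /sub]; [|exact: bot_le| |exact: le_top].
  by rewrite -(splitting_setT w e) splitting_tPi //; apply: admissible_setT.
by rewrite -(splitting_set0 w e) splitting_tPi //; apply: admissible_set0.
Qed.

Lemma fundamental_coef_segment_flag w e
    (z : cycles (proper_part (tPi w e)) (n - 2)) :
  0 < seg_end w ord0 -> fundamental_cycle z ->
  `|z (facet n (segment_flag w e))| = 1.
Proof.
move=> b_gt0 fund; apply: (boolean_fundamental_coef (graded_tPi w e)) fund _ => //.
- exact: tPi_le_atoms.
- exact: card_atoms_below.
- by apply: segment_flag_is_flag => // S; apply: splitting_tPi.
Qed.

End BooleanSubposet.

(** * Unitriangularity *)

Lemma mem_downset n (D : {set 'I_n}) :
  (forall i j : 'I_n, i <= j -> j \in D -> i \in D) ->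
  forall i, (i \in D) = (i < #|D|).
Proof.
move=> down i; have below k (kn : k <= n) := card_ord_lt_inj (@inj_id 'I_n) kn.
apply/idP/idP => [iD|].
  rewrite -[X in X <= _](below i.+1) //; apply/subset_leq_card/subsetP => j.
  by rewrite inE ltnS => ji; apply: down iD.
apply: contraLR => iD; rewrite -leqNgt -[X in _ <= X](below i) ?(ltnW (ltn_ord i)) //.
apply/subset_leq_card/subsetP => j jD; rewrite inE ltnNge.
by apply: contra iD => ij; apply: down jD.
Qed.

Lemma perm_downset n (v : 'S_n) a : a <= n ->
  (forall i j : 'I_n, i <= j -> v j < a -> v i < a) -> forall i, (v i < a) = (i < a).
Proof.
move=> an down i; have := @mem_downset n [set i | v i < a] _ i.
rewrite inE card_ord_lt_inj //; last exact: perm_inj.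
by apply=> j k jk; rewrite !inE; apply: down.
Qed.

Definition suffix_max_sum n (w : 'S_n) : nat := \sum_i w (seg_end w i).

Section Triangularity.
Variable m : nat.
Local Notation n := m.+2.
Variables (w w' : 'S_n) (e e' : {ffun 'I_n -> bool}).
Implicit Types (i j c q : 'I_n) (k : nat).
Hypothesis flag_in_tPi : forall k, 0 < k < n -> segment_flag w e k \in tPi w' e'.

Lemma segment_flag_splitting k : 0 < k < n ->
  exists S f, segment_flag w e k = splitting w' f S.
Proof. by case/flag_in_tPi/tPiP=> S _ [->|->]; exists S; eexists. Qed.

Let place : 'S_n := (w' * w^-1)%g.

Lemma place_letter i : w (place i) = w' i.
Proof. by rewrite permM permKV. Qed.

Lemma place_lt_seg_start i q : (place q < seg_start w i) = (q < seg_start w i).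
Proof.
have [->|s_gt0] := posnP (seg_start w i); first by rewrite !ltn0.
apply: perm_downset => [|j k jk]; first exact: ltnW.
have sn : 0 < seg_start w i < n by rewrite s_gt0 ltn_ord.
have [S [f flagE]] := segment_flag_splitting sn.
rewrite -(seg_end_lt_start w i (place k)) -(seg_end_lt_start w i (place j)).
rewrite -!(segment_flag_zero w e) !place_letter flagE !zero_splitting.
by move=> /forall_inP before; apply/forall_inP => c /before; apply: leq_ltn_trans.
Qed.

Lemma place_le_seg_end i q : (place q <= seg_end w i) = (q <= seg_end w i).
Proof.
have [en|en] := leqP n (seg_end w i).+1.
  have le_end j : j <= seg_end w i by rewrite -ltnS; apply: leq_trans en.
  by rewrite !le_end.
suff E : seg_start w (Ordinal en) = (seg_end w i).+1 :> nat.
  by rewrite -[LHS]ltnS -[RHS]ltnS -E place_lt_seg_start.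
by apply/eqP; rewrite eqn_leq segment_lt // (seg_start_le w (Ordinal en)).
Qed.

Lemma suffix_max_le i : w' (seg_end w' i) <= w (seg_end w i).
Proof.
rewrite -place_letter -(seg_end_start w i); apply: seg_end_max.
rewrite leqNgt place_lt_seg_start -leqNgt.
exact: leq_trans (seg_start_le w i) (seg_end_ge w' i).
Qed.

Lemma suffix_max_sum_le : suffix_max_sum w' <= suffix_max_sum w.
Proof. by apply: leq_sum => i _; apply: suffix_max_le. Qed.

Hypothesis sum_eq : suffix_max_sum w' = suffix_max_sum w.

Lemma suffix_max_eq i : w' (seg_end w' i) = w (seg_end w i).
Proof.
have [_] := leqif_sum (fun i (_ : xpredT i) => leqif_eq (suffix_max_le i)).
by rewrite -!/(suffix_max_sum _) sum_eq eqxx => /esym/forallP/(_ i)/eqP/val_inj.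
Qed.

Lemma place_seg_end i : place (seg_end w i) = seg_end w i.
Proof.
set b := seg_end w i; have := suffix_max_eq b.
rewrite -place_letter seg_endK => /perm_inj place_b.
have qb : seg_end w' b <= b by rewrite -(place_le_seg_end i) place_b.
suff E : seg_end w' b = b by move: place_b; rewrite E.
by apply/val_inj/eqP; rewrite eqn_leq qb seg_end_ge.
Qed.

Lemma place_lt_nonend i q : i != seg_end w i -> (place q < i) = (q < i).
Proof.
move=> ne; set b := seg_end w i; have ib : i < b := lt_seg_end ne.
have kn : 0 < cut_time w i < n.
  by rewrite ltn_ord andbT /= -/b; have := seg_start_le w i; lia.
have [S [f flagE]] := segment_flag_splitting kn.
apply: perm_downset => [|j k jk place_k]; first exact: ltnW.
rewrite ltnNge; apply/negP => place_j.
have kb : k <= b by rewrite -(place_le_seg_end i) ltnW // (ltn_trans place_k).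
have jb : place j <= b by rewrite place_le_seg_end (leq_trans jk).
have := segment_flag_max_block w e i (place j); rewrite place_j jb.
have := segment_flag_max_block w e i (place k); rewrite leqNgt place_k /=.
have w'b : w' b = w b by rewrite -place_letter place_seg_end.
rewrite -/b -w'b !place_letter flagE !same_splitting.
move=> /negbT/negP not_same /forall_inP same; apply: not_same.
by apply/forall_inP => c /same; rewrite -/b; move: jk kb; lia.
Qed.

Lemma perm_determined : w' = w.
Proof.
suff place1 i : place i = i by apply/permP => i; rewrite -place_letter place1.
have place_lt j q : (place q < j) = (q < j).
  have [E|] := eqVneq j (seg_end w j); last exact: place_lt_nonend.
  have place_j : place j = j by rewrite E place_seg_end.
  have := place_le_seg_end j q; rewrite -E (leq_eqVlt (place q)) (leq_eqVlt q).
  have [->|qj] := eqVneq q j; first by rewrite place_j.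
  by rewrite !val_eqE -[X in place q == X]place_j (inj_eq perm_inj) (negbTE qj).
by apply/val_inj/eqP; rewrite eqn_leq leqNgt -place_lt ltnn leqNgt place_lt ltnn.
Qed.

End Triangularity.

Section BarsDetermined.
Variable m : nat.
Local Notation n := m.+2.
Implicit Types (e f : {ffun 'I_n -> bool}).

Lemma bars_determined (w : 'S_n) e f :
  (forall k, 0 < k < n -> segment_flag w e k \in tPi w f) ->
  unbarred_maxima w e -> unbarred_maxima w f ->
  odd #|[set i | e i]| = odd #|[set i | f i]| -> e = f.
Proof.
move=> flag_in_tPi e_max f_max.
have ef i : i != ord0 -> e i = f i.
  have [E _|ne] := eqVneq i (seg_end w i); first by rewrite e_max ?f_max.
  rewrite -ord_gt0; set b := seg_end w i => i0; have ib : i < b := lt_seg_end ne.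
  have b0 : 0 < b by apply: leq_ltn_trans ib.
  have tb : letter_time w i < b <= b by rewrite letter_time_lt ?leqnn.
  have nz : ~~ same_block (segment_flag w e b) ord0 (letter_at w i).
    by rewrite segment_flag_zero ltnn.
  have link := segment_flag_linked e tb.
  have [e_b f_b] : e b = false /\ f b = false by rewrite e_max ?f_max ?seg_endK.
  have bn : 0 < b < n by rewrite b0 ltn_ord.
  have [S _ flagE] := tPiP (flag_in_tPi b bn).
  have link_f : linked (segment_flag w e b) w f i b.
    have := linked_same link; case: flagE => ->; rewrite same_splitting.
      by rewrite linked_splitting.
    by rewrite -linked_negate_first // linked_splitting.
  by have := related_uniq nz link link_f; rewrite -/b e_b f_b !addbF.
have others : [set i | f i] :\ ord0 = [set i | e i] :\ ord0.
  by apply/setP => i; rewrite !inE; case: eqVneq => //= /ef->.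
rewrite !odd_bars_first others => /addIb ef0; apply/ffunP => i.
by have [->|/ef] := eqVneq i ord0.
Qed.

Lemma support_suffix_max_sum (x y : Dn n)
    (z : cycles (proper_part (tPi x.1 x.2)) (n - 2)) :
  basis_index x -> basis_index y -> x != y ->
  z (facet n (segment_flag y.1 y.2)) != 0%R ->
  suffix_max_sum x.1 < suffix_max_sum y.1.
Proof.
move=> /basis_indexP[_ x_max] /basis_indexP[_ y_max] xy nz.
have /andP[+ _] := implyP (forallP (cycle_is_chain z) _) nz.
rewrite inE => /andP[/subsetP sub _].
have in_tPi k : 0 < k < n -> segment_flag y.1 y.2 k \in tPi x.1 x.2.
  move=> kn; have /sub : segment_flag y.1 y.2 k \in facet n (segment_flag y.1 y.2).
    by apply/facetP; exists k.
  by rewrite inE => /andP[].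
rewrite ltn_neqAle (suffix_max_sum_le in_tPi) andbT; apply: contra xy => /eqP sum_eq.
have perm_eq := perm_determined in_tPi sum_eq; apply/eqP/val_inj.
case: x y {nz sub z} x_max y_max in_tPi sum_eq perm_eq
  => [[w e] even_e] [[v f] even_f] /=.
move=> e_max f_max in_tPi _ E; rewrite E in in_tPi e_max *; congr (_, _).
by apply/esym/(bars_determined in_tPi) => //; rewrite (negbTE even_e) (negbTE even_f).
Qed.

End BarsDetermined.

Theorem theorem8p4 (n : nat) (hn : (2 <= n)%N)
    (rho : forall x : Dn n, cycles (proper_part (tPi x.1 x.2)) (n - 2))
    (hrho : forall x : Dn n, fundamental_cycle (rho x)) :
  Zbasis (V := homology (proper_part (PiD n)) (n - 2))
    (fun x : {x : Dn n | basis_index x} =>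
       homology_class (cycle_incl (proper_partS (tPi_sub _ _)) (rho (sval x)))).
Proof.
case: n hn rho hrho => [|[|m]] // hn rho hrho; set n := m.+2 in hn rho hrho *.
apply: Zbasis_homology => [s|]; first exact: top_dimension_card (graded_PiD m) hn _.
pose basis_coef (x : {x : Dn n | basis_index x}) : {additive _ -> int} :=
  @cycle_coef _ _ (proper_part (PiD n)) (n - 2)
    (facet n (segment_flag (sval x).1 (sval x).2)).
pose weight (x : {x : Dn n | basis_index x}) := suffix_max_sum (sval x).1.
apply: (unitriangular_Zbasis (coord := basis_coef) (weight := weight)).
- move=> z coef0; apply: val_inj; apply: cycle_vanish => [||x bx].
  + exact: top_cycle_is_chain hn _.
  + exact: cycle_boundary.
  + exact: (coef0 (exist _ x bx)).
- move=> x; have [b_gt0 _] := basis_indexP _ (valP x).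
  exact: fundamental_coef_segment_flag.
move=> x y xy; apply: (support_suffix_max_sum (z := rho (sval x))).
- exact: valP.
- exact: valP.
by rewrite (inj_eq val_inj).
Qed.
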